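(* Let $X$ be a nonzero complex Banach space and let $T$ be a bounded linear operator on $X$. If $T$ is weakly hypercyclic, then every component of the spectrum $\sigma(T)$ meets the unit circle $\{z\in\mathbb{C} : |z|=1\}$.
   Context: For a bounded linear operator $T$ on a Banach space $X$ and $x\in X$, the orbit of $x$ is $\mathrm{Orb}_T x=\{T^n x\}_{n\geq 0}$. The vector $x$ is called weakly hypercyclic for $T$ if $\mathrm{Orb}_T x$ is dense in $X$ with respect to the weak topology of $X$. The operator $T$ is called weakly hypercyclic if it has a weakly hypercyclic vector. A component of $\sigma(T)$ means a (nonempty) connected component. *)

(* Defs.v *)
From HB Require Import structures.
From mathcomp Require Import all_boot all_order all_algebra.
From mathcomp Require Import all_classical all_reals all_analysis.
From mathcomp Require Export complex.

Set Implicit Arguments.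
Unset Strict Implicit.
Unset Printing Implicit Defensive.

Import Order.TTheory GRing.Theory Num.Theory.
Import numFieldNormedType.Exports.

Local Open Scope classical_set_scope.
Local Open Scope ring_scope.
Local Open Scope complex_scope.

(* The norm of a normed module over R[i] takes its values in R[i], and
   a <= b in R[i] means that b - a is a nonnegative real. The scalar field,
   seen as a normed space or as a topological space, is R[i]^o. *)

Definition bounded_operator (R : realType) (V W : normedModType R[i])
    (f : V -> W) : Prop :=
  exists M : R, forall x : V, `|f x| <= M%:C * `|x|.

Definition topological_dual (R : realType) (V : normedModType R[i]) : Type :=
  {f : {linear V -> R[i]^o} | bounded_operator f}.

Definition weak_space (R : realType) (V : normedModType R[i]) :
    topologicalType :=
  sup_topology (fun f : topological_dual V =>
    Topological.on (initial_topology (sval f : V -> R[i]^o))).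

Definition operator_orbit (V : Type) (T : V -> V) (x : V) : set V :=
  [set iter n T x | n in [set: nat]].

Definition weakly_hypercyclic_vector (R : realType) (V : normedModType R[i])
    (T : V -> V) (x : V) : Prop :=
  @dense (weak_space V) (operator_orbit T x).

Definition weakly_hypercyclic (R : realType) (V : normedModType R[i])
    (T : V -> V) : Prop :=
  exists x : V, weakly_hypercyclic_vector T x.

Definition spectrum (R : realType) (V : normedModType R[i]) (T : V -> V) :
    set R[i]^o :=
  [set z | ~ exists S : {linear V -> V},
      [/\ bounded_operator S,
          forall x, S (T x - z *: x) = x
        & forall x, T (S x) - z *: S x = x]].

(* The components of A are the sets connected_component A z for z in A;
   for z outside A the library's connected_component A z is empty. *)
Definition is_component (Y : topologicalType) (A C : set Y) : Prop :=
  exists2 z, A z & C = connected_component A z.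

(* Main.v *)
(* Suppose that a component of the spectrum of T, the one of l, misses the unit
   circle. By compactness some part S1 of the spectrum contains l, is at positive
   distance from the rest, and lies in |z| <= 1 - e or in |z| >= 1 + e. The edges
   between squares of a fine grid that meet S1 and squares that do not form a
   contour in the resolvent set. For h holomorphic near S1 let h(T) be the
   integral of h(z) (T - z)^-1 over this contour; then h(T) T = (z h)(T), because
   the integral of h is 0. If 1(T) vanished, the operator of 1 / (z - l) would be
   a nonzero multiple of (T - l)^-1, as the contour winds around l. Hence
   P = 1(T) is nonzero.

   If S1 is inside the circle, P T^n = (z^n)(T) is bounded uniformly in n, so for
   a functional f with f P <> 0 the values f (P T^n x) are bounded, and the orbit
   of x is not weakly dense.

   If S1 is outside, put L_j = (z^-j)(T), so that ||L_j|| <= B q^j with q < 1 and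
   L_(k+j) T^k = L_j. Weak density forces P x <> 0, and we choose f with
   f (P x) <> 0. For m with q^m small and r < m, a greedy choice of coefficients
   c_i in {0, 1} makes g_r = sum_i c_i f L_(r + m i) satisfy
   |g_r (T^(r + m k) x)| >= |f (P x)| / 4 for all k. So the orbit of x avoids the
   weak neighbourhood of 0 where all |g_r|, r < m, are less than |f (P x)| / 4. *)
From HB Require Import structures.
Require Import Defs.
From mathcomp Require Import all_boot all_order all_algebra.
From mathcomp Require Import all_classical all_reals all_analysis.
From mathcomp Require Import ring lra.
Import Order.TTheory GRing.Theory Num.Theory.
Import numFieldNormedType.Exports.
Set Implicit Arguments.
Unset Strict Implicit.
Unset Printing Implicit Defensive.
Local Open Scope classical_set_scope.
Local Open Scope ring_scope.
Local Open Scope complex_scope.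

(** * Norms with real values *)

Definition rnorm (R : realType) (V : normedZmodType R[i]) (x : V) : R :=
  complex.Re `|x|.

Section RealNorm.
Variable R : realType.

Lemma real_complex_inj : injective (fun x : R => x%:C).
Proof. by move=> x y []. Qed.

Lemma norm_rnorm (V : normedZmodType R[i]) (x : V) : `|x| = (rnorm x)%:C.
Proof. by rewrite /rnorm RRe_real // normr_real. Qed.

Lemma rnorm_ge0 (V : normedZmodType R[i]) (x : V) : 0 <= rnorm x.
Proof. by rewrite -lecR -norm_rnorm; exact: normr_ge0. Qed.

Lemma rnorm0 (V : normedZmodType R[i]) : rnorm (0 : V) = 0.
Proof. by rewrite /rnorm normr0. Qed.

Lemma rnorm_eq0 (V : normedZmodType R[i]) (x : V) : (rnorm x == 0) = (x == 0).
Proof. by rewrite -(normr_eq0 x) norm_rnorm -(inj_eq real_complex_inj). Qed.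

Lemma rnormN (V : normedZmodType R[i]) (x : V) : rnorm (- x) = rnorm x.
Proof. by rewrite /rnorm normrN. Qed.

Lemma rdistC (V : normedZmodType R[i]) (x y : V) : rnorm (x - y) = rnorm (y - x).
Proof. by rewrite /rnorm distrC. Qed.

Lemma ler_rnormD (V : normedZmodType R[i]) (x y : V) :
  rnorm (x + y) <= rnorm x + rnorm y.
Proof. by rewrite -lecR raddfD /= -!norm_rnorm ler_normD. Qed.

Lemma ler_rdistD (V : normedZmodType R[i]) (z x y : V) :
  rnorm (x - y) <= rnorm (x - z) + rnorm (z - y).
Proof. by rewrite -[x - y](subrKA z) ler_rnormD. Qed.

Lemma ler_rnorm_sum (V : normedZmodType R[i]) (I : Type) (r : seq I)
    (P : pred I) (F : I -> V) :
  rnorm (\sum_(i <- r | P i) F i) <= \sum_(i <- r | P i) rnorm (F i).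
Proof.
elim/big_ind2: _ => [|x1 x2 y1 y2 h1 h2|//]; first by rewrite rnorm0.
exact: le_trans (ler_rnormD _ _) (lerD h1 h2).
Qed.

Lemma rnormZ (V : normedModType R[i]) (a : R[i]) (x : V) :
  rnorm (a *: x) = rnorm a * rnorm x.
Proof. by apply: real_complex_inj; rewrite rmorphM /= -!norm_rnorm normrZ. Qed.

Lemma rnormM (a b : R[i]) : rnorm (a * b) = rnorm a * rnorm b.
Proof. by apply: real_complex_inj; rewrite rmorphM /= -!norm_rnorm normrM. Qed.

Lemma rnormV (a : R[i]) : rnorm a^-1 = (rnorm a)^-1.
Proof. by apply: real_complex_inj; rewrite fmorphV /= -!norm_rnorm normfV. Qed.

Lemma rnorm1 : rnorm (1 : R[i]) = 1.
Proof. by rewrite /rnorm normr1. Qed.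

Lemma rnormX (a : R[i]) n : rnorm (a ^+ n) = rnorm a ^+ n.
Proof. by elim: n => [|n IH]; rewrite ?expr0 ?rnorm1 // !exprS rnormM IH. Qed.

Lemma rnorm_real (a : R) : rnorm (a%:C) = `|a|.
Proof. by rewrite /rnorm normc_def /= expr0n addr0 sqrtr_sqr. Qed.

Lemma rnormi : rnorm ('i : R[i]) = 1.
Proof. by rewrite /rnorm normc_def /= expr0n expr1n add0r sqrtr1. Qed.

Lemma ler_rnormB (V : normedZmodType R[i]) (x y : V) :
  rnorm x - rnorm y <= rnorm (x - y).
Proof. by rewrite lerBlDr -{1}[x](subrK y) ler_rnormD. Qed.

Lemma ler_Re_rnorm (a : R[i]) : `|complex.Re a| <= rnorm a.
Proof. by rewrite -lecR -norm_rnorm normc_ge_Re. Qed.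

Lemma ler_Im_rnorm (a : R[i]) : `|complex.Im a| <= rnorm a.
Proof.
have := ler_Re_rnorm (a * 'i); rewrite rnormM rnormi mulr1.
by case: a => x y /=; rewrite !mulr0 !mulr1 sub0r normrN.
Qed.

Lemma ler_rnorm_ReIm (a : R[i]) :
  rnorm a <= `|complex.Re a| + `|complex.Im a|.
Proof.
rewrite [a in rnorm a]complexE; apply: le_trans (ler_rnormD _ _) _.
by rewrite rnormM rnormi mul1r !rnorm_real.
Qed.

Lemma bounded_operatorP (V W : normedModType R[i]) (f : V -> W) :
  bounded_operator f <->
  exists2 M : R, 0 < M & forall x, rnorm (f x) <= M * rnorm x.
Proof.
split=> [[M hM]|[M _ hM]]; last first.
  by exists M => x; rewrite !norm_rnorm -rmorphM /= lecR.
exists (`|M| + 1) => [|x]; first by rewrite ltr_wpDl.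
have := hM x; rewrite !norm_rnorm -rmorphM /= lecR => /le_trans; apply.
apply: ler_wpM2r; first exact: rnorm_ge0.
by rewrite (le_trans (ler_norm _)) // lerDl.
Qed.

Lemma rball (V : normedModType R[i]) (x y : V) (e : R) :
  ball x e%:C y <-> rnorm (x - y) < e.
Proof. by rewrite -ball_normE /ball_ /= norm_rnorm ltcR. Qed.

Lemma rnbhsP (V : normedModType R[i]) (x : V) (A : set V) :
  nbhs x A <-> exists2 e : R, 0 < e & forall y, rnorm (x - y) < e -> A y.
Proof.
split=> [/nbhs_ballP[e /= e0 he]|[e e0 he]].
  have eE : e = (complex.Re e)%:C by rewrite RRe_real // gtr0_real.
  exists (complex.Re e); first by rewrite -ltcR -eE.
  by move=> y /rball; rewrite -eE => /he.
apply/nbhs_ballP; exists e%:C => /=; first by rewrite ltcR.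
by move=> y /rball/he.
Qed.

End RealNorm.

(** * Convergence at the rate 1 / 2^n *)

Section GeometricConvergence.
Variable R : realType.

Lemma half_exp_lt (C e : R) : 0 < e -> exists N, forall n, (N <= n)%N ->
  C / 2 ^+ n < e.
Proof.
move=> e0; pose m := Num.bound `|C / e|.
exists m => n mn; rewrite ltr_pdivrMr ?exprn_gt0 // mulrC -ltr_pdivrMr //.
have /lt_le_trans : C / e < m%:R.
  by apply: le_lt_trans (ler_norm _) _; apply: archi_boundP; exact: normr_ge0.
apply; rewrite -natrX ler_nat; exact: leq_trans mn (ltnW (ltn_expl _ _)).
Qed.

Lemma eq0_le_half_exp (V : normedZmodType R[i]) (x : V) (C : R) :
  (forall n, rnorm x <= C / 2 ^+ n) -> x = 0.
Proof.
move=> h; apply/eqP; rewrite -rnorm_eq0; apply/negP => /negP x0.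
have x_gt0 : 0 < rnorm x by rewrite lt_neqAle eq_sym x0 rnorm_ge0.
have [N hN] := half_exp_lt C x_gt0.
by have := lt_le_trans (hN N (leqnn N)) (h N); rewrite ltxx.
Qed.

(** The subtracted term makes the induction on k close with equality: a step costs C / 2^(m + k),
    exactly the amount by which 2 C / 2^(m + k) drops. *)
Lemma geometric_dist (V : normedZmodType R[i]) (u : nat -> V) (C : R) :
  (forall n, rnorm (u n.+1 - u n) <= C / 2 ^+ n) ->
  forall m k, rnorm (u (m + k)%N - u m) <= 2 * C / 2 ^+ m - 2 * C / 2 ^+ (m + k).
Proof.
move=> h m; elim=> [|k IH]; first by rewrite addn0 !subrr rnorm0.
rewrite addnS; apply: le_trans (ler_rdistD (u (m + k)%N) _ _) _.
have := h (m + k)%N; rewrite exprS invfM.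
set t := (2 ^+ (m + k))^-1 in IH *; set s := _^-1 in IH *; lra.
Qed.

Lemma geometric_cvg (X : completeNormedModType R[i]) (u : nat -> X) (C : R) :
  (forall n, rnorm (u n.+1 - u n) <= C / 2 ^+ n) ->
  exists l, forall n, rnorm (u n - l) <= 2 * C / 2 ^+ n.
Proof.
move=> h.
have C0 : 0 <= C by have := le_trans (rnorm_ge0 _) (h 0%N); rewrite expr0 divr1.
have dist_le m n : (m <= n)%N -> rnorm (u n - u m) <= 2 * C / 2 ^+ m.
  move=> /subnKC <-; apply: le_trans (geometric_dist h m (n - m)) _.
  by rewrite lerBlDr lerDl divr_ge0 ?mulr_ge0 ?exprn_ge0.
have : cvgn u.
  apply: cauchy_cvg; apply/cauchyP => e e0.
  have eE : e = (complex.Re e)%:C by rewrite RRe_real // gtr0_real.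
  have e0' : 0 < complex.Re e by rewrite -ltcR -eE.
  have [N hN] := half_exp_lt (2 * C) e0'.
  exists (u N); exists N => // n /= Nn; rewrite eE; apply/rball.
  by rewrite rdistC; exact: le_lt_trans (dist_le _ _ Nn) (hN _ _).
move=> /cvg_ex[l ul]; exists l => n; apply/ler_addgt0Pr => e e0.
have /ul [N _ hN] : nbhs l [set y | rnorm (l - y) < e].
  by apply/rnbhsP; exists e.
have := hN (maxn N n) (leq_maxl _ _); rewrite /= => lt_e.
apply: le_trans (ler_rdistD (u (maxn N n)) _ _) _; apply: lerD.
  by rewrite rdistC; apply: dist_le; exact: leq_maxr.
by rewrite rdistC ltW.
Qed.

End GeometricConvergence.

(** * Components of compact plane sets *)

Section PlaneTopology.
Variable R : realType.
Implicit Types (S K : set R[i]^o) (l z w : R[i]^o).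

Lemma continuous_realC_pair :
  continuous (fun p : R^o * R^o => (p.1 +i* p.2 : R[i]^o)).
Proof.
move=> [a b] A /rnbhsP[e e0 hA] /=.
exists (ball a (e / 2), ball b (e / 2)).
  by split => /=; apply: nbhsx_ballx; rewrite divr_gt0.
move=> [c d] [/= ac bd]; apply: hA => /=.
apply: le_lt_trans (ler_rnorm_ReIm _) _ => /=.
move: ac bd; rewrite -ball_normE /ball_ /= => ac bd.
by rewrite [e]splitr ltrD.
Qed.

(** Heine-Borel: K is a closed part of the image of a compact square under (a, b) -> a + i b. *)
Lemma compact_plane K (M : R) :
  closed K -> (forall z, K z -> rnorm z <= M) -> compact K.
Proof.
move=> clK bK.
have cpt : compact ((fun p : R^o * R^o => (p.1 +i* p.2 : R[i]^o)) @`
    (`[- M, M]%classic `*` `[- M, M]%classic)).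
  apply: continuous_compact; last by apply: compact_setX; exact: segment_compact.
  exact/continuous_subspaceT/continuous_realC_pair.
apply: subclosed_compact clK cpt _ => z Kz.
have zM := bK _ Kz.
exists (complex.Re z, complex.Im z); last by case: (z : R[i]).
split => /=; rewrite in_itv /= -ler_norml.
  exact: le_trans (ler_Re_rnorm _) zM.
exact: le_trans (ler_Im_rnorm _) zM.
Qed.

(* Cantor's intersection theorem, in the form in which it is applied to
   decreasing families indexed by a positive real tending to 0. *)
Lemma compact_cluster K (F : R -> set R[i]^o) : compact K ->
  (forall e, 0 < e -> F e `&` K !=set0) ->
  (forall d e, 0 < d -> d <= e -> F d `<=` F e) ->
  exists2 z, K z & forall e, 0 < e -> exists2 w, F e w & rnorm (w - z) < e.
Proof.
move=> /compact_near_coveringP cK F0 Fmono; apply: contrapT => hN.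
have loc z : K z -> exists2 e, 0 < e & forall w, F e w -> e <= rnorm (w - z).
  move=> Kz; apply: contrapT => h; apply: hN; exists z => // e e0.
  apply: contrapT => h'; apply: h; exists e => // w Fw; rewrite leNgt.
  by apply/negP => wz; apply: h'; exists w.
(* By compactness the local radii yield one bound below which every F e misses K, against [F0]. *)
have : \forall e \near (0 : R)^'+, K `<=` [set w | ~ F e w].
  apply: (cK R (0 : R)^'+ (fun e w => ~ F e w)) => z Kz.
  have [e e0 he] := loc z Kz.
  exists ([set w | rnorm (z - w) < e], [set d | 0 < d] `&` [set d | d < e]).
    split => /=; first by apply/rnbhsP; exists e.
    by apply: filterI; [exact: nbhs_right_gt|exact: nbhs_right_lt].
  case=> w d [/= zw] [d0 de] Fw.
  have := he w (Fmono _ _ d0 (ltW de) _ Fw).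
  by rewrite rdistC leNgt zw.
move=> /nbhs_ballP[e /= e0 he].
have e20 : 0 < e / 2 by rewrite divr_gt0.
have [w [Fw Kw]] := F0 _ e20.
apply: (he (e / 2) _ e20 w Kw Fw).
rewrite -ball_normE /ball_ /= sub0r normrN gtr0_norm //.
by rewrite ltr_pdivrMr // ltr_pMr // ltr1n.
Qed.

End PlaneTopology.

(** * Chains with small steps and connectedness *)

Section Chains.
Variable R : realType.
Variables (S : set R[i]^o) (l : R[i]^o).
Implicit Types (e d : R) (z w : R[i]^o).
Hypothesis Sl : S l.
Hypothesis cptS : compact S.

(* The points of S joined to l by a chain in S with steps smaller than e. *)
Definition chain_component e : set R[i]^o :=
  [set z | S z /\ forall B : set R[i]^o, B l ->
    (forall u v, B u -> S v -> rnorm (u - v) < e -> B v) -> B z].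

Lemma chain_component_refl e : chain_component e l.
Proof. by split. Qed.

Lemma chain_component_step e z w : chain_component e z -> S w ->
  rnorm (z - w) < e -> chain_component e w.
Proof.
move=> [Sz hz] Sw zw; split=> // B Bl hB.
exact: (hB z w (hz B Bl hB) Sw zw).
Qed.

Lemma chain_component_sub d e : d <= e ->
  chain_component d `<=` chain_component e.
Proof.
move=> de z [Sz hz]; split=> // B Bl hB; apply: hz => // u v Bu Sv uv.
exact: (hB u v Bu Sv (lt_le_trans uv de)).
Qed.

(** For compact S this set is connected, so it lies in the component of l; its description by chains
    lends itself to limits e -> 0. *)
Definition quasi_component : set R[i]^o :=
  [set z | forall e, 0 < e -> chain_component e z].

Lemma quasi_component_refl : quasi_component l.
Proof. by move=> e _; exact: chain_component_refl. Qed.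

Lemma quasi_component_subset : quasi_component `<=` S.
Proof. by move=> z /(_ 1 ltr01)[]. Qed.

(** By compactness the given points accumulate at some z of S. For each e this z is less than e away
    from a point of [chain_component e], hence belongs to it. *)
Lemma quasi_component_limit (F : R -> set R[i]^o) :
  (forall e, 0 < e -> exists2 z, F e z & chain_component e z) ->
  (forall d e, 0 < d -> d <= e -> F d `<=` F e) ->
  exists2 z, quasi_component z &
    forall e, 0 < e -> exists2 w, F e w & rnorm (w - z) < e.
Proof.
move=> F0 Fmono.
have [|d e d0 de z [Fz cz]|z Sz hz] :=
    @compact_cluster R S (fun e => F e `&` chain_component e) cptS.
- by move=> e /F0[z Fz cz]; exists z; split=> //; case: cz.
- by split; [exact: Fmono Fz|exact: chain_component_sub cz].
exists z => e e0; have [w [Fw cw] wz] := hz e e0; last by exists w.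
exact: chain_component_step cw Sz wz.
Qed.

(** Chains from l to a point b off B must leave B, so points of the quasi-component off B come
    arbitrarily close to B. A limit of such points can lie neither in B, because O is open, nor off
    B, because F is closed. *)
Lemma quasi_component_clopen (B O F : set R[i]^o) :
  open O -> closed F -> B = quasi_component `&` O ->
  B = quasi_component `&` F -> B l -> quasi_component `<=` B.
Proof.
move=> oO cF BO BF Bl b Kb; apply: contrapT => nBb.
have near_B d : 0 < d -> exists2 z, quasi_component z /\ ~ B z &
    exists2 u, B u & rnorm (u - z) < d.
  move=> d0; apply: contrapT => h.
  have d20 : 0 < d / 2 by rewrite divr_gt0.
  (* Unless b itself is closer than d to B, a chain from l to b with steps below e has a first point
     outside the d/2-neighbourhood of B, and this point lies in G e. The limit z of such points is
     off B and closer than d to B. *)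
  pose G e := [set z | (forall u, B u -> d / 2 <= rnorm (u - z)) /\
    exists2 u, B u & rnorm (u - z) < d / 2 + e].
  have [||z Kz hz] := @quasi_component_limit G.
  - move=> e e0; apply: contrapT => hG.
    have [_ /(_ ([set v | chain_component e v /\
      exists2 u, B u & rnorm (u - v) < d / 2]))] := Kb e e0.
    case=> [||_ [u Bu ub]].
    + by split; [exact: chain_component_refl | exists l => //; rewrite subrr rnorm0].
    + move=> u v [cu [u' Bu' u'u]] Sv uv.
      have cv := chain_component_step cu Sv uv; split=> //.
      apply: contrapT => hv; apply: hG; exists v => //; split.
        by move=> t Bt; rewrite leNgt; apply/negP => tv; apply: hv; exists t.
      exists u' => //; apply: le_lt_trans (ler_rdistD u _ _) _.
      exact: ltrD.
    by apply: h; exists b => //; exists u => //; apply: lt_trans ub _; lra.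
  - move=> e f e0 ef z [h1 [u Bu uz]]; split=> //; exists u => //.
    by apply: lt_le_trans uz _; rewrite lerD2l.
  apply: h; exists z.
    split=> // Bz; have [w [/(_ z Bz) h1 _]] := hz _ d20.
    by rewrite rdistC ltNge h1.
  have d40 : 0 < d / 4 by rewrite divr_gt0.
  have [w [_ [u Bu uw]] wz] := hz _ d40; exists u => //.
  by apply: le_lt_trans (ler_rdistD w _ _) _; lra.
pose G e := [set z | (quasi_component z /\ ~ B z) /\
    exists2 u, B u & rnorm (u - z) < e].
have [||z Kz hz] := @quasi_component_limit G.
- by move=> e e0; have [z [h1 h2] h3] := near_B e e0; exists z => //; exact: h1.
- move=> e f e0 ef z [h1 [u Bu uz]]; split=> //; exists u => //.
  exact: lt_le_trans uz ef.
have [Bz|nBz] := pselect (B z).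
  have Oz : O z by move: Bz; rewrite BO => -[].
  have /rnbhsP[e e0 he] : nbhs z O by apply: open_nbhs_nbhs.
  have [w [[Kw nBw] _] wz] := hz e e0; apply: nBw; rewrite BO; split=> //.
  by apply: he; rewrite rdistC.
have nFz : (~` F) z by move=> Fz; apply: nBz; rewrite BF.
have /rnbhsP[e e0 he] : nbhs z (~` F).
  by apply: open_nbhs_nbhs; split=> //; exact: closed_openC.
have e20 : 0 < e / 2 by rewrite divr_gt0.
have [w [_ [u Bu uw]] wz] := hz _ e20.
apply: (he u); last by move: Bu; rewrite BF => -[].
by rewrite rdistC; apply: le_lt_trans (ler_rdistD w _ _) _; lra.
Qed.

Lemma quasi_component_connected : connected quasi_component.
Proof.
move=> B [b Bb] [U oU BU] [F cF BF].
have BK : B `<=` quasi_component by rewrite BU => z [].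
apply/seteqP; split=> //.
have [Bl|nBl] := pselect (B l); first exact: quasi_component_clopen oU cF BU BF Bl.
(* Here l lies in the complement of B, to which the previous lemma applies with the open and the
   closed description exchanged. *)
suff /(_ b (BK b Bb))[] : quasi_component `<=` quasi_component `\` B by [].
apply: (@quasi_component_clopen _ (~` F) (~` U) (closed_openC cF)
  (open_closedC oU)).
- by apply/seteqP; split=> z [Kz h]; split=> // h'; apply: h; move: h'; rewrite BF //; case.
- by apply/seteqP; split=> z [Kz h]; split=> // h'; apply: h; move: h'; rewrite BU //; case.
- by split=> //; exact: quasi_component_refl.
Qed.

(** For some e the e-chains from l keep distance e from the circle, since otherwise a limit point of
    the quasi-component would lie on it. Steps shorter than e cannot jump from |z| <= 1 - e to |z|
    >= 1 + e, so these chains stay on the side of l. *)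
Lemma component_avoiding_circle :
  (forall z, connected_component S l z -> rnorm z != 1) ->
  exists2 e : R, 0 < e & exists S1 : set R[i]^o,
    [/\ S1 `<=` S, S1 l,
        forall z w, S1 z -> S w -> rnorm (z - w) < e -> S1 w
      & (forall z, S1 z -> rnorm z <= 1 - e) \/
        (forall z, S1 z -> 1 + e <= rnorm z)].
Proof.
move=> hC.
have [e e0 he] : exists2 e, 0 < e & forall z, chain_component e z ->
    e <= `|rnorm z - 1|.
  apply: contrapT => hN.
  have [||z Kz hz] := @quasi_component_limit
      (fun e => [set z | `|rnorm z - 1| < e]).
  - move=> e e0; apply: contrapT => h; apply: hN; exists e => // z cz.
    by rewrite leNgt; apply/negP => ze; apply: h; exists z.
  - by move=> d e d0 de z /= zd; exact: lt_le_trans zd de.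
  have /negP := hC z (connected_component_max quasi_component_refl
    quasi_component_subset quasi_component_connected Kz); apply.
  apply/eqP; apply: contrapT => /eqP; rewrite -subr_eq0 -normr_gt0 => z1.
  have z20 : 0 < `|rnorm z - 1| / 2 by rewrite divr_gt0.
  have [w /= w1 wz] := hz _ z20.
  have := ler_rnormB z w; have := ler_rnormB w z; rewrite (rdistC z w).
  by move: w1 wz z1; case: (ler0P (rnorm z - 1)); case: (ler0P (rnorm w - 1)); lra.
exists e => //; exists (chain_component e); split.
- by move=> z [].
- exact: chain_component_refl.
- by move=> z w cz Sw; exact: chain_component_step cz Sw.
have [l1|l1] := ltP (rnorm l) 1; [left|right].
  move=> z cz; have [_ /(_ [set z | chain_component e z /\ rnorm z < 1])] := cz.
  case=> [||_].
  - by split=> //; exact: chain_component_refl.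
  - move=> u v [cu u1] Sv uv; split; first exact: chain_component_step cu Sv uv.
    have := he _ cu; have := ler_rnormB v u; rewrite (rdistC v u).
    by move: u1 uv; case: ler0P; lra.
  by have := he _ cz; case: ler0P; lra.
move=> z cz; have [_ /(_ [set z | chain_component e z /\ 1 <= rnorm z])] := cz.
case=> [||_].
- by split=> //; exact: chain_component_refl.
- move=> u v [cu u1] Sv uv; split; first exact: chain_component_step cu Sv uv.
  have := he _ cu; have := ler_rnormB u v.
  by move: u1 uv; case: ler0P; lra.
by have := he _ cz; case: ler0P; lra.
Qed.

End Chains.

(** * Hahn-Banach *)

Section HahnBanach.
Variables (R : realType) (V : normedModType R[i]).
Implicit Types (p q : V -> R) (x y u v : V).

(** Homogeneity is stated as an inequality for t > 0 and the bound by the norm is built in, so that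
    the notion passes to infima. *)
Definition sublinear p := [/\ forall x y, p (x + y) <= p x + p y,
  forall t x, 0 < t -> p (t%:C *: x) <= t * p x & forall x, p x <= rnorm x].

Lemma sublinear_scale p t x : sublinear p -> 0 <= t -> p (t%:C *: x) = t * p x.
Proof.
move=> [pD pZ pn]; rewrite le_eqVlt => /predU1P[<-|t0].
  rewrite mul0r scale0r; apply/eqP; rewrite eq_le.
  have := pD 0 0; have := pn 0; rewrite addr0 rnorm0; lra.
apply/eqP; rewrite eq_le pZ //=.
have tV0 : 0 < t^-1 by rewrite invr_gt0.
have := pZ t^-1 (t%:C *: x) tV0.
rewrite scalerA -rmorphM /= mulVf ?gt_eqF // scale1r => h.
by rewrite -ler_pdivlMl.
Qed.

Lemma sublinear0 p : sublinear p -> p 0 = 0.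
Proof.
by move=> sp; have := sublinear_scale 0 sp (lexx 0); rewrite scale0r mul0r.
Qed.

Lemma sublinear_oppr p x : sublinear p -> - p (- x) <= p x.
Proof.
move=> sp; have [pD _ _] := sp.
by have := pD x (- x); rewrite subrr sublinear0 //; lra.
Qed.

(** The witness k is free, so that one statement serves both an infimum along a chain, where k is
    one of the given indices, and an infimum over shifts t, where k is a sum or a product. *)
Lemma sublinear_inf (I : Type) (D : set I) (F : I -> V -> R) : D !=set0 ->
  (forall x, exists m, forall i, D i -> m <= F i x) ->
  (forall i x, D i -> exists2 k, D k & F k x <= rnorm x) ->
  (forall i j x y, D i -> D j -> exists2 k, D k & F k (x + y) <= F i x + F j y) ->
  (forall i t x, D i -> 0 < t -> exists2 k, D k & F k (t%:C *: x) <= t * F i x) ->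
  exists2 q, sublinear q & forall i x, D i -> q x <= F i x.
Proof.
move=> [i0 Di0] Flb Fn FD FZ.
pose q x := inf [set F i x | i in D].
have q_le i x : D i -> q x <= F i x.
  move=> Di; apply: ge_inf; last by exists i.
  by have [m hm] := Flb x; exists m => _ [k Dk <-]; exact: hm.
have le_q x b : (forall i, D i -> b <= F i x) -> b <= q x.
  move=> h; apply: lb_le_inf; first by exists (F i0 x), i0.
  by move=> _ [k Dk <-]; exact: h.
exists q => //; split.
- move=> x y; rewrite -lerBlDr; apply: (le_q) => i Di.
  rewrite lerBlDr -lerBlDl; apply: (le_q) => j Dj.
  rewrite lerBlDl; have [k Dk] := FD i j x y Di Dj.
  by apply: le_trans; exact: q_le.
- move=> t x t0; rewrite -ler_pdivrMl //; apply: (le_q) => i Di.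
  rewrite ler_pdivrMl //; have [k Dk] := FZ i t x Di t0.
  by apply: le_trans; exact: q_le.
- move=> x; have [k Dk] := Fn i0 x Di0.
  by apply: le_trans; exact: q_le.
Qed.

(** Take q x to be the infimum over t >= 0 of p (x + t u) - t p u: the choice t = 0 gives q <= p,
    and t = 1 gives the value at - u. *)
Lemma sublinear_below p u : sublinear p ->
  exists q, [/\ sublinear q, forall x, q x <= p x & q (- u) <= - p u].
Proof.
move=> sp; have [pD pZ pn] := sp.
have [||t x Dt|s t x y Ds Dt|s t x Ds t0|q sq hq] :=
  @sublinear_inf R [set t : R | 0 <= t]
    (fun t x => p (x + t%:C *: u) - t * p u).
- by exists 0 => /=.
- move=> x; exists (- p (- x)) => t t0.
  rewrite -(sublinear_scale u sp t0).
  by have := pD (x + t%:C *: u) (- x); rewrite addrAC subrr add0r; lra.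
- by exists 0 => //=; rewrite scale0r addr0 mul0r subr0.
- exists (s + t); first exact: addr_ge0.
  rewrite rmorphD /= scalerDl addrACA.
  by have := pD (x + s%:C *: u) (y + t%:C *: u); lra.
- exists (t * s); first by apply: mulr_ge0 => //; exact: ltW.
  rewrite rmorphM /= -scalerA -scalerDr.
  by have := pZ t (x + s%:C *: u) t0; lra.
exists q; split=> // [x|].
  by have := hq 0 x (lexx 0); rewrite scale0r addr0 mul0r subr0.
by have := hq 1 (- u) ler01; rewrite scale1r addNr sublinear0 // mul1r sub0r.
Qed.

Lemma sublinear_rnorm : sublinear (@rnorm R V).
Proof.
split=> // [x y|t x t0]; first exact: ler_rnormD.
by rewrite rnormZ rnorm_real gtr0_norm.
Qed.

(* A minimal sublinear functional is linear: it cannot lie strictly above the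
   functional given by [sublinear_below]. *)
Lemma exists_real_functional v : exists p, [/\ forall x y, p (x + y) = p x + p y,
  forall t x, p (t%:C *: x) = t * p x, forall x, `|p x| <= rnorm x &
  p v = rnorm v].
Proof.
(* A bound at - v passes to smaller functionals and becomes p v >= |v| once p is odd. The order
   [le_] is reversed, so that Zorn's lemma yields a minimal functional. *)
pose T := {p | sublinear p /\ p (- v) <= - rnorm v}.
have [p0 [sp0 _ p0v]] := sublinear_below v sublinear_rnorm.
pose le_ (s t : T) := `[< forall x, sval t x <= sval s x >].
have [|s r t /asboolP sr /asboolP rt|A Atot|[p [sp pv]] pmin] :=
    @ZL_preorder T (exist _ p0 (conj sp0 p0v)) le_.
- by move=> s; apply/asboolP.
- by apply/asboolP => x; exact: le_trans (rt x) (sr x).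
- have [[i0 Ai0]|A0] := pselect (A !=set0); last first.
    by exists (exist _ p0 (conj sp0 p0v)) => s As; case: A0; exists s.
  have [|x|i x Ai|i j x y Ai Aj|i t x Ai t0|q sq hq] :=
    @sublinear_inf T A (fun s => sval s).
  + by exists i0.
  + exists (- rnorm x) => i Ai; have [si _] := svalP i.
    apply: le_trans (sublinear_oppr x si).
    by have [_ _ /(_ (- x))] := si; rewrite rnormN lerN2.
  + by exists i => //; have [[_ _ ->] _] := svalP i.
  + have [[iD _ _] _] := svalP i; have [[jD _ _] _] := svalP j.
    have [/asboolP h|/asboolP h] := Atot i j Ai Aj.
    * by exists j => //; apply: le_trans (jD x y) _; rewrite lerD2r.
    * by exists i => //; apply: le_trans (iD x y) _; rewrite lerD2l.
  + by exists i => //; have [[_ iZ _] _] := svalP i; exact: iZ.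
  have qv : q (- v) <= - rnorm v.
    by apply: le_trans (hq _ _ Ai0) _; have [] := svalP i0.
  by exists (exist _ q (conj sq qv)) => s As; apply/asboolP => x; exact: hq.
have pN u : p (- u) = - p u.
  have [q [sq qp qu]] := sublinear_below u sp.
  have qv : q (- v) <= - rnorm v by exact: le_trans (qp _) pv.
  have /asboolP /= pq : le_ (exist _ q (conj sq qv)) (exist _ p (conj sp pv)).
    by apply: pmin; apply/asboolP.
  apply/eqP; rewrite eq_le (le_trans (pq (- u)) qu) /=.
  by have := sublinear_oppr (- u) sp; rewrite opprK.
have [pD pZ pn] := sp.
have pDE x y : p (x + y) = p x + p y.
  apply/eqP; rewrite eq_le pD /=.
  by have := pD (x + y) (- y); rewrite addrK pN; lra.
exists p; split=> //.
- move=> t x; have [t0|t0] := leP 0 t; first exact: sublinear_scale.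
  rewrite -[t]opprK rmorphN /= scaleNr pN sublinear_scale ?mulNr //.
  by rewrite oppr_ge0 ltW.
- move=> x; rewrite ler_norml pn andbT.
  by rewrite lerNl -pN -(rnormN x) pn.
- by apply/eqP; rewrite eq_le pn /=; have := pv; rewrite pN; lra.
Qed.

(** Complexification: for the real functional p attaining the norm at v, the map x -> p x - i p (i
    x) is complex linear with real part |v| at v. *)
Lemma exists_functional v : v != 0 ->
  exists2 f : {linear V -> R[i]^o}, bounded_operator f & f v != 0.
Proof.
move=> v0; have [p [pD pZ pn pv]] := exists_real_functional v.
pose f x : R[i]^o := p x +i* - p ('i *: x).
have flin : linear f.
  move=> [a b] x y; rewrite /f.
  have -> : (a +i* b) *: x = a%:C *: x + ('i * b%:C) *: x.
    by rewrite -scalerDl -(complexE (a +i* b)).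
  rewrite !scalerDr !pD !scalerA.
  have -> : 'i * ('i * b%:C) = (- b)%:C :> R[i].
    by rewrite mulrA -expr2 sqr_i mulN1r rmorphN.
  rewrite (mulrC 'i b%:C) (mulrC 'i a%:C) -!scalerA !pZ.
  by apply/eqP; rewrite eq_complex /=; apply/andP; split; apply/eqP; ring.
pose F : {linear V -> R[i]^o} := HB.pack f (GRing.isLinear.Build _ _ _ _ f flin).
exists F.
  apply/bounded_operatorP; exists 2 => // x.
  apply: le_trans (ler_rnorm_ReIm _) _ => /=; rewrite normrN.
  by have := pn x; have := pn ('i *: x); rewrite rnormZ rnormi mul1r; lra.
rewrite eq_complex /= pv rnorm_eq0 negb_and v0 //.
Qed.

End HahnBanach.

(** * The resolvent *)

Section Resolvent.
Variables (R : realType) (X : completeNormedModType R[i]).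
Implicit Types (A B S T : {linear X -> X}) (x y : X) (z w : R[i]^o).

(** As A contracts by 1/2, 1 - A is injective, and iterating x -> y + A x from 0 converges to a
    solution of x - A x = y. Linearity of the inverse follows from injectivity. *)
Lemma neumann_series A : (forall x, rnorm (A x) <= 2^-1 * rnorm x) ->
  exists B, [/\ forall y, rnorm (B y) <= 2 * rnorm y,
    forall x, B (x - A x) = x & forall y, B y - A (B y) = y].
Proof.
move=> hA.
have small x : x - A x = 0 -> x = 0.
  move=> /subr0_eq xA; apply/eqP; rewrite -rnorm_eq0.
  by have := hA x; rewrite -xA; have := rnorm_ge0 x; lra.
have inj x x' : x - A x = x' - A x' -> x = x'.
  move=> h; apply/subr0_eq/small; rewrite linearB /=.
  have -> : x - x' - (A x - A x') = (x - A x) - (x' - A x').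
    by rewrite !opprD !opprK addrACA.
  by rewrite h subrr.
have surj y : exists x, x - A x = y.
  pose u n := iter n (fun x => y + A x) 0.
  have [|l hl] := @geometric_cvg R X u (rnorm y).
    elim=> [|n IH]; first by rewrite /= linear0 addr0 subr0 expr0 divr1.
    rewrite /u !iterS -/(u n) -/(u n.+1) opprD addrACA subrr add0r -linearB.
    apply: le_trans (hA _) _; rewrite exprS invfM.
    by rewrite mulrCA ler_pM2l // invr_gt0.
  exists l; apply/subr0_eq/(@eq0_le_half_exp R X _ (4 * rnorm y)) => n.
  have -> : l - A l - y = (l - u n.+1) + (A (u n) - A l).
    by rewrite /u iterS -/(u n) opprD !addrA subrK addrAC.
  apply: le_trans (ler_rnormD _ _) _; rewrite -linearB.
  have := hA (u n - l); have := hl n; have := hl n.+1.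
  rewrite (rdistC l) exprS invfM; have : 0 <= (2 ^+ n : R)^-1.
    by rewrite invr_ge0 exprn_ge0.
  by set t := _^-1; have := rnorm_ge0 y; nra.
pose f y := projT1 (cid (surj y)).
have fE y : f y - A (f y) = y by rewrite /f; case: cid.
have flin : linear f.
  move=> a y y'; apply: inj.
  rewrite fE linearP opprD addrACA -scalerBr !fE //.
pose B : {linear X -> X} := HB.pack f (GRing.isLinear.Build _ _ _ _ f flin).
exists B; split=> // [y|x]; last by apply: inj; exact: fE.
have := ler_rnormB (B y) (A (B y)); rewrite [B y - _]fE.
by have := hA (B y); lra.
Qed.

Definition resolvent T z S :=
  (forall x, S (T x - z *: x) = x) /\ (forall x, T (S x) - z *: S x = x).

Lemma spectrumPn T z : ~ spectrum T z <->
  exists S, exists2 M : R, 0 < M & resolvent T z S /\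
    forall x, rnorm (S x) <= M * rnorm x.
Proof.
split=> [/contrapT[S [/bounded_operatorP[M M0 hM] h1 h2]]|[S [M M0 [[h1 h2] hM]]]].
  by exists S, M.
by apply; exists S; split=> //; apply/bounded_operatorP; exists M.
Qed.

(** T - w = (T - z) (1 - (w - z) S), and [neumann_series] inverts the second factor at the cost of a
    factor 2. *)
Lemma resolvent_perturbation T z w S (M : R) : resolvent T z S ->
  (forall x, rnorm (S x) <= M * rnorm x) -> rnorm (w - z) * M <= 2^-1 ->
  exists2 S', resolvent T w S' & forall x, rnorm (S' x) <= 2 * M * rnorm x.
Proof.
move=> [ST TS] hM wz.
have [|B [hB BA AB]] := @neumann_series ((w - z) \*: S).
  move=> x /=; rewrite rnormZ; apply: le_trans (_ : rnorm (w - z) * (M * rnorm x) <= _).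
    by apply: ler_wpM2l => //; exact: rnorm_ge0.
  by rewrite mulrA ler_wpM2r // rnorm_ge0.
have shift x : T x - w *: x = T x - z *: x - (w - z) *: x.
  by rewrite scalerBl opprB addrA subrK.
(* B inverts 1 - (w - z) S and so commutes with S; this makes B S a right inverse as well. *)
have SB y : B (S y) = S (B y).
  by rewrite -{1}(AB y) /= linearB linearZ /= BA.
exists (B \o S); last first.
  move=> x /=; apply: le_trans (hB _) _; rewrite -mulrA ler_wpM2l //.
split=> x /=.
  by rewrite shift linearB ST linearZ /= BA.
by rewrite SB shift TS AB.
Qed.

(** T - z = - z (1 - T / z), and T / z contracts by 1/2. The absolute value and the + 1 force z <> 0
    whatever the sign of M. *)
Lemma spectrum_bounded T (M : R) : (forall x, rnorm (T x) <= M * rnorm x) ->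
  forall z, spectrum T z -> rnorm z <= 2 * `|M| + 1.
Proof.
move=> hM z; apply: contraPle => zM; apply/spectrumPn.
have M0 := normr_ge0 M.
have z_gt0 : 0 < rnorm z by lra.
have z0 : z != 0 by rewrite -rnorm_eq0 gt_eqF.
have [|B [hB BA AB]] := @neumann_series (z^-1 \*: T).
  move=> x /=; rewrite rnormZ rnormV ler_pdivrMl //.
  apply: le_trans (hM x) _; rewrite mulrA ler_wpM2r ?rnorm_ge0 //.
  by apply: le_trans (ler_norm _) _; lra.
exists (- z^-1 \*: B), (rnorm z^-1 * 2).
  by rewrite mulr_gt0 // rnormV invr_gt0.
split; first split=> x /=.
- rewrite -linearZ /= scaleNr scalerBr scalerA mulVf // scale1r opprB.
  exact: BA.
- rewrite linearZ /= scalerA mulrN mulfV // scaleN1r opprK -[RHS]AB /= addrC.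
  by rewrite scaleNr.
- by move=> x; rewrite /= rnormZ rnormN -mulrA ler_wpM2l ?rnorm_ge0.
Qed.

Lemma compact_spectrum T : bounded_operator T -> compact (spectrum T).
Proof.
move=> /bounded_operatorP[M M0 hM].
apply: compact_plane (spectrum_bounded hM) => z; apply: contraPP.
move=> /spectrumPn[S [N N0 [hS hN]]] /(_ [set w | rnorm (z - w) < (2 * N)^-1]).
case=> [|w [Sw /= zw]].
  by apply/rnbhsP; exists (2 * N)^-1 => //; rewrite invr_gt0 mulr_gt0.
have [|S' hS' hN'] := @resolvent_perturbation T z w S N hS hN.
  rewrite rdistC; have := ltW zw; rewrite invfM => h.
  by apply: le_trans (ler_wpM2r (ltW N0) h) _; rewrite mulfVK ?gt_eqF.
suff : ~ spectrum T w by [].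
by apply/spectrumPn; exists S', (2 * N) => //; rewrite mulr_gt0.
Qed.

Lemma resolvent_identity T z w S S' : resolvent T z S -> resolvent T w S' ->
  forall x, S x - S' x = (z - w) *: S (S' x).
Proof.
move=> [ST TS] [ST' TS'] x.
have -> : S x = S (T (S' x) - w *: S' x) by rewrite TS'.
have -> : T (S' x) - w *: S' x = T (S' x) - z *: S' x + (z - w) *: S' x.
  by rewrite scalerBl addrA subrK.
by rewrite linearD ST linearZ /= [S' x + _]addrC addrK.
Qed.

Lemma resolvent_commutes T z S x : resolvent T z S -> S (T x) = T (S x).
Proof.
move=> [ST TS]; apply: (addIr (- (z *: S x))).
by rewrite TS -linearZ -linearB ST.
Qed.

End Resolvent.

(** * Contour integrals *)

Section ContourSums.
Variable R : realType.
Implicit Types (a d p z w : R[i]) (n k : nat) (s t : R).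

Section RiemannSums.
Variable V : lmodType R[i].

(* Riemann sum with respect to the parameter t of a + t d: the factor d of the
   line integral is put in the weights of [contour_sum]. *)
Definition segment_sum n a d (g : R[i] -> V) : V :=
  (2 ^- n)%:C *: \sum_(k < 2 ^ n) g (a + (k%:R / 2 ^+ n)%:C * d).

(* The triple (a, d, w) stands for the segment [a, a + d] with weight w. *)
Definition contour_sum (E : seq (R[i] * R[i] * R[i])) n (g : R[i] -> V) : V :=
  \sum_(e <- E) e.2 *: segment_sum n e.1.1 e.1.2 g.

Lemma segment_sumP n a d c (g h : R[i] -> V) :
  segment_sum n a d (fun z => c *: g z + h z) =
  c *: segment_sum n a d g + segment_sum n a d h.
Proof.
rewrite /segment_sum big_split /= scalerDr -scaler_sumr; congr (_ + _).
by rewrite !scalerA [c * _]mulrC.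
Qed.

Lemma contour_sumP E n c (g h : R[i] -> V) :
  contour_sum E n (fun z => c *: g z + h z) =
  c *: contour_sum E n g + contour_sum E n h.
Proof.
rewrite /contour_sum scaler_sumr -big_split /=; apply: eq_bigr => e _.
by rewrite segment_sumP scalerDr !scalerA [c * _]mulrC.
Qed.

End RiemannSums.

Definition segment a d : set R[i] :=
  [set z | exists2 t : R, 0 <= t <= 1 & z = a + t%:C * d].

Definition contour_support (E : seq (R[i] * R[i] * R[i])) : set R[i] :=
  [set z | exists2 e, e \in E & segment e.1.1 e.1.2 z].

Definition contour_weight (E : seq (R[i] * R[i] * R[i])) : R :=
  \sum_(e <- E) rnorm e.2.

Lemma segment_node n a d (k : 'I_(2 ^ n)) :
  segment a d (a + (k%:R / 2 ^+ n)%:C * d).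
Proof.
exists (k%:R / 2 ^+ n) => //; rewrite divr_ge0 ?exprn_ge0 //=.
by rewrite ler_pdivrMr ?exprn_gt0 // mul1r -natrX ler_nat ltnW.
Qed.

Lemma eq_segment_sum (V : lmodType R[i]) n a d (g h : R[i] -> V) :
  (forall z, segment a d z -> g z = h z) ->
  segment_sum n a d g = segment_sum n a d h.
Proof.
move=> gh; rewrite /segment_sum; congr (_ *: _); apply: eq_bigr => k _.
exact/gh/segment_node.
Qed.

Lemma eq_contour_sum (V : lmodType R[i]) E n (g h : R[i] -> V) :
  (forall z, contour_support E z -> g z = h z) ->
  contour_sum E n g = contour_sum E n h.
Proof.
move=> gh; rewrite /contour_sum big_seq [RHS]big_seq; apply: eq_bigr => e eE.
by congr (_ *: _); apply: eq_segment_sum => z ez; apply: gh; exists e.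
Qed.

Lemma contour_sum_map (V W : lmodType R[i]) (f : {linear V -> W}) E n g :
  contour_sum E n (fun z => f (g z)) = f (contour_sum E n g).
Proof.
rewrite /contour_sum /segment_sum (linear_sum f); apply: eq_bigr => e _.
by rewrite !(linearZ_LR f) /= (linear_sum f).
Qed.

Lemma contour_sumZ (V : lmodType R[i]) E n (h : R[i] -> R[i]^o) (x : V) :
  contour_sum E n (fun z => h z *: x) = contour_sum E n h *: x.
Proof.
rewrite /contour_sum /segment_sum scaler_suml; apply: eq_bigr => e _.
by rewrite -scaler_suml !scalerA.
Qed.

Lemma rnorm_segment_sum (V : normedModType R[i]) n a d (g : R[i] -> V) (M : R) :
  (forall z, segment a d z -> rnorm (g z) <= M) ->
  rnorm (segment_sum n a d g) <= M.
Proof.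
move=> gM; rewrite /segment_sum rnormZ rnorm_real ger0_norm ?invr_ge0 ?exprn_ge0 //.
rewrite ler_pdivrMl ?exprn_gt0 //; apply: le_trans (ler_rnorm_sum _ _ _) _.
have -> : 2 ^+ n * M = \sum_(k < 2 ^ n) M.
  by rewrite sumr_const card_ord -[RHS]mulr_natl natrX.
by apply: ler_sum => k _; exact/gM/segment_node.
Qed.

Lemma rnorm_contour_sum (V : normedModType R[i]) E n (g : R[i] -> V) (M : R) :
  (forall z, contour_support E z -> rnorm (g z) <= M) ->
  rnorm (contour_sum E n g) <= contour_weight E * M.
Proof.
move=> gM; apply: le_trans (ler_rnorm_sum _ _ _) _.
rewrite /contour_weight mulr_suml big_seq [leRHS]big_seq; apply: ler_sum => e eE.
rewrite rnormZ ler_wpM2l ?rnorm_ge0 //; apply: rnorm_segment_sum => z ez.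
by apply: gM; exists e.
Qed.

(** Level n + 1 keeps the old nodes and adds the midpoints, so the difference is a weighted sum of
    increments of g over half steps. *)
Lemma segment_sum_step (V : normedModType R[i]) n a d (g : R[i] -> V) (L : R) :
  (forall z w, segment a d z -> segment a d w ->
    rnorm (g z - g w) <= L * rnorm (z - w)) ->
  rnorm (segment_sum n.+1 a d g - segment_sum n a d g) <= L * rnorm d / 2 ^+ n.
Proof.
move=> gL; have exp2_neq0 : 2 ^+ n != 0 :> R by rewrite expf_neq0 // pnatr_eq0.
have -> : segment_sum n.+1 a d g - segment_sum n a d g = (2 ^- n.+1)%:C *:
    \sum_(k < 2 ^ n) (g (a + (k.*2.+1%:R / 2 ^+ n.+1)%:C * d)
                      - g (a + (k%:R / 2 ^+ n)%:C * d)).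
  rewrite /segment_sum expnS mul2n -addnn.
  have -> : \sum_(k < 2 ^ n + 2 ^ n) g (a + (k%:R / 2 ^+ n.+1)%:C * d) =
      \sum_(k < 2 ^ n) (g (a + (k%:R / 2 ^+ n)%:C * d) +
                        g (a + (k.*2.+1%:R / 2 ^+ n.+1)%:C * d)).
    rewrite addnn; elim: (2 ^ n)%N => [|m IH]; first by rewrite !big_ord0.
    rewrite doubleS !big_ord_recr /= IH -addrA; congr (_ + (g (_ + _%:C * _) + _)).
    rewrite -muln2 natrM exprS; field; exact: exp2_neq0.
  have -> : 2 ^- n = 2 ^- n.+1 + 2 ^- n.+1 :> R.
    by rewrite exprS invfM -mulrDl -[2^-1]mul1r -splitr mul1r.
  rewrite big_split sumrB /= scalerBr scalerDr rmorphD /= scalerDl opprD.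
  by rewrite addrACA subrr add0r.
rewrite rnormZ rnorm_real ger0_norm ?invr_ge0 ?exprn_ge0 //.
rewrite ler_pdivrMl ?exprn_gt0 //; apply: le_trans (ler_rnorm_sum _ _ _) _.
have -> : 2 ^+ n.+1 * (L * rnorm d / 2 ^+ n) = \sum_(k < 2 ^ n) (2 * L * rnorm d / 2 ^+ n).
  rewrite sumr_const card_ord -[RHS]mulr_natl natrX exprS.
  by field.
apply: ler_sum => k _.
have k1 : segment a d (a + (k.*2.+1%:R / 2 ^+ n.+1)%:C * d).
  have kn : (k.*2.+1 < 2 ^ n.+1)%N by rewrite expnS mul2n ltn_Sdouble.
  exact: (segment_node a d (Ordinal kn)).
apply: le_trans (gL _ _ k1 (segment_node a d k)) _.
rewrite opprD addrACA subrr add0r -mulrBl rnormM -rmorphB /= rnorm_real.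
have -> : k.*2.+1%:R / 2 ^+ n.+1 - k%:R / 2 ^+ n = 2 ^- n.+1 :> R.
  rewrite -addn1 natrD -muln2 natrM exprS.
  by field.
(* The sign comes from the Lipschitz bound between the two ends of the segment. *)
have gd : 0 <= L * rnorm d.
  have sa : segment a d a by exists 0; rewrite ?lexx ?ler01 // mul0r addr0.
  have sd : segment a d (a + d) by exists 1; rewrite ?lexx ?ler01 // mul1r.
  have := gL _ _ sd sa; rewrite [a + d]addrC addrK.
  exact/le_trans/rnorm_ge0.
have q0 : 0 <= 2 ^- n :> R by rewrite invr_ge0 exprn_ge0.
rewrite ger0_norm ?invr_ge0 ?exprn_ge0 // exprS invfM.
have := mulr_ge0 gd q0; set q := 2 ^- n; nra.
Qed.

End ContourSums.

Section ContourIntegral.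
Variable R : realType.
Implicit Types (E : seq (R[i] * R[i] * R[i])) (n : nat).

(** With the rate in the definition, uniqueness, linearity and norm bounds reduce to estimates at a
    fixed n; [geometric_cvg] supplies the rate. *)
Definition contour_integral (V : normedModType R[i]) E (g : R[i] -> V) (l : V) :=
  exists C : R, forall n, rnorm (contour_sum E n g - l) <= C / 2 ^+ n.

Section Integral.
Variable V : normedModType R[i].
Implicit Types (g h : R[i] -> V) (l m : V).

Lemma contour_integral_unique E g l m :
  contour_integral E g l -> contour_integral E g m -> l = m.
Proof.
move=> [C hC] [D hD]; apply/subr0_eq/(@eq0_le_half_exp R V _ (C + D)) => n.
apply: le_trans (ler_rdistD (contour_sum E n g) _ _) _.
by rewrite mulrDl rdistC lerD.
Qed.

Lemma contour_integralP E g h l m (c : R[i]) : contour_integral E g l ->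
  contour_integral E h m ->
  contour_integral E (fun z => c *: g z + h z) (c *: l + m).
Proof.
move=> [C hC] [D hD]; exists (rnorm c * C + D) => n.
rewrite contour_sumP opprD addrACA -scalerBr mulrDl.
apply: le_trans (ler_rnormD _ _) _; rewrite rnormZ -mulrA lerD //.
by rewrite ler_wpM2l ?rnorm_ge0.
Qed.

Lemma eq_contour_integral E g h l : (forall z, contour_support E z -> g z = h z) ->
  contour_integral E g l -> contour_integral E h l.
Proof. by move=> gh [C hC]; exists C => n; rewrite -(eq_contour_sum n gh). Qed.

Lemma rnorm_contour_integral E g l (M : R) :
  (forall z, contour_support E z -> rnorm (g z) <= M) ->
  contour_integral E g l -> rnorm l <= contour_weight E * M.
Proof.
move=> gM [C hC]; apply/ler_addgt0Pr => e e0.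
have [N hN] := half_exp_lt C e0.
have := rnorm_contour_sum N gM; have := ltW (hN N (leqnn N)); have := hC N.
have := ler_rnormB l (contour_sum E N g); rewrite (rdistC l); lra.
Qed.

End Integral.

Lemma contour_integral_map (V W : normedModType R[i]) (f : {linear V -> W}) E g l :
  bounded_operator f -> contour_integral E g l ->
  contour_integral E (fun z => f (g z)) (f l).
Proof.
move=> /bounded_operatorP[M M0 hM] [C hC]; exists (M * C) => n.
rewrite contour_sum_map -linearB; apply: le_trans (hM _) _.
by rewrite -mulrA ler_pM2l.
Qed.

Lemma contour_integralZ (V : normedModType R[i]) E (h : R[i] -> R[i]^o) c (x : V) :
  contour_integral E h c -> contour_integral E (fun z => h z *: x) (c *: x).
Proof.
move=> [C hC]; exists (C * rnorm x) => n.
by rewrite contour_sumZ -scalerBl rnormZ mulrAC ler_wpM2r ?rnorm_ge0.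
Qed.

Lemma contour_integral_ex (X : completeNormedModType R[i]) E (g : R[i] -> X)
    (L : R) :
  (forall z w, contour_support E z -> contour_support E w ->
    rnorm (g z - g w) <= L * rnorm (z - w)) ->
  exists l, contour_integral E g l.
Proof.
move=> gL; pose C := \sum_(e <- E) rnorm e.2 * (L * rnorm e.1.2).
have [n|l hl] := @geometric_cvg R X (contour_sum E ^~ g) C; last first.
  by exists l; exists (2 * C).
rewrite /contour_sum -sumrB /C mulr_suml; apply: le_trans (ler_rnorm_sum _ _ _) _.
rewrite big_seq [leRHS]big_seq; apply: ler_sum => e eE.
rewrite -scalerBr rnormZ -mulrA ler_wpM2l ?rnorm_ge0 //.
by apply: segment_sum_step => z w ez ew; apply: gL; exists e.
Qed.

End ContourIntegral.

(** * Cauchy's theorem and the winding number for a square *)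

Section Squares.
Variable R : realType.
Implicit Types (p z w : R[i]) (n k : nat) (s t : R) (h : R[i] -> R[i]^o).

Definition square p s : set R[i] := [set z |
  (0 <= complex.Re (z - p) <= s) && (0 <= complex.Im (z - p) <= s)].

(** The boundary runs counterclockwise; the top and left sides are parametrised in the positive
    direction, hence the minus signs. *)
Definition square_sum n p s h : R[i] :=
  s%:C * segment_sum n p s%:C h
  + ('i * s%:C) * segment_sum n (p + s%:C) ('i * s%:C) h
  - s%:C * segment_sum n (p + 'i * s%:C) s%:C h
  - ('i * s%:C) * segment_sum n p ('i * s%:C) h.

Lemma square_diam p s z w : square p s z -> square p s w ->
  rnorm (z - w) <= 2 * s.
Proof.
move=> /andP[z1 z2] /andP[w1 w2]; apply: le_trans (ler_rnorm_ReIm _) _.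
move: z p w z1 z2 w1 w2 => [z1 z2] [p1 p2] [w1 w2] /=.
move=> /andP[h1 h2] /andP[h3 h4] /andP[h5 h6] /andP[h7 h8].
have : `|z1 - w1| <= s by rewrite ler_norml; apply/andP; split; lra.
have : `|z2 - w2| <= s by rewrite ler_norml; apply/andP; split; lra.
lra.
Qed.

(* Cauchy's theorem for a square, by subdivision: the Riemann sum of level n
   over the boundary is the sum over 4^n small squares of side s / 2^n of terms
   which the differentiability of h makes of order (s / 2^n)^3. *)
Lemma square_cauchy n p s h (h' : R[i] -> R[i]) (M : R) : 0 <= s ->
  (forall z w, square p s z -> square p s w ->
    rnorm (h w - h z - h' z * (w - z)) <= M * rnorm (w - z) ^+ 2) ->
  rnorm (square_sum n p s h) <= 2 * M * s ^+ 3 / 2 ^+ n.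
Proof.
move=> s0 hh; pose t := s / 2 ^+ n; pose N := (2 ^ n)%N.
have exp2_gt0 : 0 < 2 ^+ n :> R by rewrite exprn_gt0.
have t0 : 0 <= t by rewrite divr_ge0 // ltW.
pose q j k := p + ((j%:R * t) +i* (k%:R * t)).
pose G j k : R[i] := h (q j k).
have sq j k : (j <= N)%N -> (k <= N)%N -> square p s (q j k).
  move=> jN kN; rewrite /square /= /q addrC addKr /= !mulr_ge0 //=.
  have le_s m : (m <= N)%N -> m%:R * t <= s.
    by move=> mN; rewrite /t mulrA ler_pdivrMr // mulrC ler_wpM2l // -natrX ler_nat.
  by rewrite !le_s.
have segE a d (f : nat -> R[i]) : (forall k : 'I_N,
    h (a + (k%:R / 2 ^+ n)%:C * d) = f k) ->
    segment_sum n a d h = (2 ^- n)%:C * \sum_(k < N) f k.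
  by move=> hf; rewrite /segment_sum; congr (_ * _); apply: eq_bigr => k _.
have tE : t%:C = s%:C * (2 ^- n)%:C by rewrite /t rmorphM.
(* Each cell contributes one node per side; the sides shared by two cells cancel by telescoping. *)
have sumE : square_sum n p s h = \sum_(j < N) \sum_(k < N)
    t%:C * (G j k - G j k.+1 + 'i * (G j.+1 k - G j k)).
  have -> : \sum_(j < N) \sum_(k < N)
      t%:C * (G j k - G j k.+1 + 'i * (G j.+1 k - G j k)) =
      t%:C * (\sum_(j < N) (G j 0%N - G j N) +
      'i * \sum_(k < N) (G N k - G 0%N k)).
    have tele (f : nat -> R[i]) : \sum_(j < N) (f j.+1 - f j) = f N - f 0%N.
      by rewrite -(big_mkord xpredT (fun j => f j.+1 - f j)) telescope_sumr.
    rewrite mulrDr !mulr_sumr.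
    transitivity (\sum_(j < N) \sum_(k < N) t%:C * (G j k - G j k.+1) +
        \sum_(j < N) \sum_(k < N) t%:C * ('i * (G j.+1 k - G j k))).
      rewrite -big_split; apply: eq_bigr => j _; rewrite -big_split.
      by apply: eq_bigr => k _; rewrite mulrDr.
    congr (_ + _).
      apply: eq_bigr => j _; rewrite -mulr_sumr; congr (_ * _).
      rewrite -[RHS]opprB -(tele (G j)) -sumrN.
      by apply: eq_bigr => k _; rewrite opprB.
    rewrite exchange_big /=; apply: eq_bigr => k _.
    by rewrite -!mulr_sumr (tele (G ^~ k)).
  rewrite /square_sum (segE _ _ (G ^~ 0%N)); last first.
    move=> k; rewrite /G /q; congr (h (_ + _)).
    by rewrite mul0r -rmorphM /= /t; congr (_%:C); field; exact: lt0r_neq0.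
  rewrite (segE _ _ (G N)); last first.
    move=> k; rewrite /G /q -addrA; congr (h (_ + _)).
    rewrite mulrCA -rmorphM /= [RHS]complexE /= /t; congr (_%:C + _ * _%:C).
      by rewrite natrX; field; exact: lt0r_neq0.
    by field; exact: lt0r_neq0.
  rewrite (segE _ _ (G ^~ N)); last first.
    move=> k; rewrite /G /q -addrA; congr (h (_ + _)).
    rewrite addrC -rmorphM /= [RHS]complexE /= /t; congr (_%:C + _ * _%:C).
      by field; exact: lt0r_neq0.
    by rewrite natrX; field; exact: lt0r_neq0.
  rewrite (segE _ _ (G 0%N)); last first.
    move=> k; rewrite /G /q; congr (h (_ + _)).
    rewrite mulrCA -rmorphM /= [RHS]complexE /= mul0r add0r; congr (_ * _%:C).
    by rewrite /t; field; exact: lt0r_neq0.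
  rewrite !sumrB tE; ring.
rewrite sumE; apply: le_trans (_ : \sum_(j < N) \sum_(k < N) 2 * M * t ^+ 3 <= _).
  apply: le_trans (ler_rnorm_sum _ _ _) (ler_sum _ _) => j _.
  apply: le_trans (ler_rnorm_sum _ _ _) (ler_sum _ _) => k _.
  have jN := ltn_ord j; have kN := ltn_ord k.
  rewrite rnormM rnorm_real ger0_norm //.
  have e1 := hh _ _ (sq j k (ltnW jN) (ltnW kN)) (sq j k.+1 (ltnW jN) kN).
  have e2 := hh _ _ (sq j k (ltnW jN) (ltnW kN)) (sq j.+1 k jN (ltnW kN)).
  have d1 : q j k.+1 - q j k = 'i * t%:C.
    rewrite /q opprD addrACA subrr add0r [RHS]complexE; apply/eqP.
    by rewrite eq_complex /=; apply/andP; split; apply/eqP; rewrite -?natr1; ring.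
  have d2 : q j.+1 k - q j k = t%:C.
    rewrite /q opprD addrACA subrr add0r; apply/eqP.
    by rewrite eq_complex /=; apply/andP; split; apply/eqP; rewrite -?natr1; ring.
  rewrite d1 rnormM rnormi mul1r rnorm_real ger0_norm // in e1.
  rewrite d2 rnorm_real ger0_norm // in e2.
  set X1 := (X in rnorm X <= _) in e1; set X2 := (X in rnorm X <= _) in e2.
  (* The linear parts cancel because h' (i t) - i (h' t) = 0; only the two quadratic remainders are
     left. *)
  have -> : G j k - G j k.+1 + 'i * (G j.+1 k - G j k) = - X1 + 'i * X2.
    by rewrite /X1 /X2 /G; ring.
  have -> : 2 * M * t ^+ 3 = t * (M * t ^+ 2 + M * t ^+ 2) by ring.
  apply: ler_wpM2l => //; apply: le_trans (ler_rnormD _ _) _.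
  by rewrite rnormN rnormM rnormi mul1r lerD.
rewrite !sumr_const !card_ord -[leLHS]mulr_natl -[X in _ * X]mulr_natl natrX.
rewrite le_eqVlt; apply/orP; left; apply/eqP; rewrite /t; field.
exact: lt0r_neq0.
Qed.

Lemma Im_segment_sum n (a d : R[i]) h (c : R) :
  (forall z, segment a d z -> c <= complex.Im (d * h z)) ->
  c <= complex.Im (d * segment_sum n a d h).
Proof.
move=> hc; have -> : complex.Im (d * segment_sum n a d h) =
    2 ^- n * \sum_(k < 2 ^ n) complex.Im (d * h (a + (k%:R / 2 ^+ n)%:C * d)).
  rewrite /segment_sum.
  have ImZ (r : R) (u : R[i]) : complex.Im (r%:C * u) = r * complex.Im u.
    by case: u => u1 u2 /=; rewrite mul0r addr0.
  have Im_sum (F : nat -> R[i]) m :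
      complex.Im (\sum_(k < m) F k) = \sum_(k < m) complex.Im (F k).
    by elim: m => [|m IH]; rewrite ?big_ord0 // !big_ord_recr /= -IH; case: (\sum_(_ < _) _); case: (F m).
  rewrite -[_ *: _]/(_ * _) mulrCA ImZ mulr_sumr; congr (_ * _).
  exact: (Im_sum (fun k => d * h (a + (k%:R / 2 ^+ n)%:C * d))).
rewrite mulrC ler_pdivlMr ?exprn_gt0 //.
have -> : c * 2 ^+ n = \sum_(k < 2 ^ n) c.
  by rewrite sumr_const card_ord -[RHS]mulr_natr natrX.
by apply: ler_sum => k _; exact/hc/segment_node.
Qed.

(* Im (dz / z) >= 1 / |side| along the boundary of a square centred at 0. *)
Lemma square_winding n l s : 0 < s ->
  4 <= complex.Im (square_sum n (l - ((s / 2) +i* (s / 2))) s (fun z => (z - l)^-1)).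
Proof.
move=> s0; pose r := s / 2; have r0 : 0 < r by rewrite divr_gt0.
have sr : s = 2 * r by rewrite /r; field.
(* Im (d / z) = (d2 x - d1 y) / |z|^2 for z measured from the centre. On each side the numerator is
   s r = 2 r^2, while |z|^2 <= 2 r^2 by [ineq], so each side contributes at least 1. *)
have key (d1 d2 x y : R) : 0 < x ^+ 2 + y ^+ 2 -> x ^+ 2 + y ^+ 2 <= d2 * x - d1 * y ->
    1 <= complex.Im ((d1 +i* d2) * (x +i* y)^-1).
  move=> D0 h; rewrite /= -/(_ / _).
  have -> : d1 * - (y / (x ^+ 2 + y ^+ 2)) + d2 * (x / (x ^+ 2 + y ^+ 2)) =
    (d2 * x - d1 * y) / (x ^+ 2 + y ^+ 2) by field; exact: lt0r_neq0.
  by rewrite ler_pdivlMr // mul1r.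
have ineq t : 0 <= t <= 1 -> (- r + t * s) ^+ 2 <= r ^+ 2.
  move=> /andP[t0 t1]; rewrite -subr_ge0 sr.
  have -> : r ^+ 2 - (- r + t * (2 * r)) ^+ 2 = (2 * r) ^+ 2 * (t * (1 - t)) by ring.
  by rewrite mulr_ge0 ?sqr_ge0 // mulr_ge0 // subr_ge0.
have r20 : 0 < r ^+ 2 by rewrite exprn_gt0.
have segN a d : segment_sum n a d (fun z => - (z - l)^-1 : R[i]^o) =
    - segment_sum n a d (fun z => (z - l)^-1 : R[i]^o).
  by rewrite /segment_sum sumrN scalerN.
have dE : s%:C = s +i* 0 :> R[i] by [].
have diE : 'i * s%:C = 0 +i* s :> R[i].
  by apply/eqP; rewrite eq_complex /=; apply/andP; split; apply/eqP; ring.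
have bot : 1 <= complex.Im (s%:C * segment_sum n (l - (r +i* r)) s%:C
    (fun z => (z - l)^-1 : R[i]^o)).
  apply: Im_segment_sum => _ [t t01 ->].
  have -> : l - (r +i* r) + t%:C * s%:C - l = (- r + t * s) +i* (- r).
    rewrite addrAC [l - _]addrC addrK; apply/eqP; rewrite eq_complex /=.
    by apply/andP; split; apply/eqP; ring.
  by rewrite dE; apply: key; have := ineq t t01; have := sqr_ge0 (- r + t * s); rewrite ?sr; nra.
have right : 1 <= complex.Im ('i * s%:C * segment_sum n (l - (r +i* r) + s%:C)
    ('i * s%:C) (fun z => (z - l)^-1 : R[i]^o)).
  apply: Im_segment_sum => _ [t t01 ->].
  have -> : l - (r +i* r) + s%:C + t%:C * ('i * s%:C) - l = r +i* (- r + t * s).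
    rewrite addrAC [_ + s%:C - l]addrAC [l - _]addrC addrK; apply/eqP.
    by rewrite eq_complex /=; apply/andP; split; apply/eqP; rewrite ?sr; ring.
  by rewrite diE; apply: key; have := ineq t t01; have := sqr_ge0 (- r + t * s); rewrite ?sr; nra.
have top : 1 <= complex.Im (- (s%:C * segment_sum n (l - (r +i* r) + 'i * s%:C)
    s%:C (fun z => (z - l)^-1 : R[i]^o))).
  rewrite -mulrN -segN; apply: Im_segment_sum => _ [t t01 ->].
  have -> : l - (r +i* r) + 'i * s%:C + t%:C * s%:C - l = (- r + t * s) +i* r.
    rewrite addrAC [_ + 'i * s%:C - l]addrAC [l - _]addrC addrK; apply/eqP.
    by rewrite eq_complex /=; apply/andP; split; apply/eqP; rewrite ?sr; ring.
  rewrite mulrN -mulNr.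
  have -> : - s%:C = - s +i* 0 :> R[i] by apply/eqP; rewrite eq_complex /= oppr0 !eqxx.
  by apply: key; have := ineq t t01; have := sqr_ge0 (- r + t * s); rewrite ?sr; nra.
have left : 1 <= complex.Im (- ('i * s%:C * segment_sum n (l - (r +i* r))
    ('i * s%:C) (fun z => (z - l)^-1 : R[i]^o))).
  rewrite -mulrN -segN; apply: Im_segment_sum => _ [t t01 ->].
  have -> : l - (r +i* r) + t%:C * ('i * s%:C) - l = - r +i* (- r + t * s).
    rewrite addrAC [l - _]addrC addrK; apply/eqP; rewrite eq_complex /=.
    by apply/andP; split; apply/eqP; ring.
  rewrite mulrN -mulNr.
  have -> : - ('i * s%:C) = 0 +i* (- s) :> R[i].
    by rewrite diE; apply/eqP; rewrite eq_complex /= oppr0 !eqxx.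
  by apply: key; have := ineq t t01; have := sqr_ge0 (- r + t * s); rewrite ?sr; nra.
have ImD (a b : R[i]) : complex.Im (a + b) = complex.Im a + complex.Im b.
  by case: a; case: b.
rewrite /square_sum -/r !ImD; lra.
Qed.

End Squares.

(** * Functions with uniform differentiability bounds *)

Section UniformlyDifferentiable.
Variable R : realType.
Implicit Types (U : set R[i]) (h k : R[i] -> R[i]^o) (z w a : R[i]) (M : R).

(* The Lipschitz and remainder bounds are required, not derived from the bound
   on h', because U need not be convex. *)
Definition uniformly_differentiable U h := exists (h' : R[i] -> R[i]) (M : R),
  0 <= M /\ forall z, U z -> [/\ rnorm (h z) <= M, rnorm (h' z) <= M &
    forall w, U w -> rnorm (h w - h z) <= M * rnorm (w - z) /\
      rnorm (h w - h z - h' z * (w - z)) <= M * rnorm (w - z) ^+ 2].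

Lemma uniformly_differentiable_cst U a : uniformly_differentiable U (fun=> a).
Proof.
exists (fun=> 0), (rnorm a); split=> [|z Uz]; first exact: rnorm_ge0.
rewrite rnorm0 rnorm_ge0; split=> // w Uw.
rewrite subrr mul0r subrr rnorm0 !mulr_ge0 ?exprn_ge0 ?rnorm_ge0 //.
Qed.

Lemma uniformly_differentiable_id U M : (forall z, U z -> rnorm z <= M) ->
  uniformly_differentiable U id.
Proof.
move=> UM; exists (fun=> 1), (1 + `|M|); split=> [|z Uz].
  by rewrite addr_ge0.
have M0 := normr_ge0 M; have MM := ler_norm M; have zM := UM z Uz.
rewrite rnorm1; split; [by lra|by lra|move=> w Uw].
rewrite mul1r subrr rnorm0 ler_peMl ?rnorm_ge0 ?lerDl //.
by rewrite mulr_ge0 ?exprn_ge0 ?rnorm_ge0 // addr_ge0.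
Qed.

Lemma uniformly_differentiableM U h k : uniformly_differentiable U h ->
  uniformly_differentiable U k -> uniformly_differentiable U (fun z => h z * k z).
Proof.
move=> [h' [M [M0 hM]]] [k' [N [N0 kN]]].
have MN := mulr_ge0 M0 N0.
(* The remainder of the product splits into three terms, each at most M N |w - z|^2; hence the
   factor 3. *)
exists (fun z => h' z * k z + h z * k' z), (3 * (M * N)).
split=> [|z Uz]; first by rewrite mulr_ge0.
have [h1 h2 h3] := hM z Uz; have [k1 k2 k3] := kN z Uz.
have bd (u v : R[i]) (A B : R) : rnorm u <= A -> rnorm v <= B ->
    rnorm (u * v) <= A * B.
  by move=> uA vB; rewrite rnormM ler_pM ?rnorm_ge0.
have := bd _ _ _ _ h1 k1; have := bd _ _ _ _ h2 k1; have := bd _ _ _ _ h1 k2.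
move=> b1 b2 b3; split.
- lra.
- by apply: le_trans (ler_rnormD _ _) _; lra.
move=> w Uw; have [h4 h5] := h3 w Uw; have [k4 k5] := k3 w Uw.
have [hw _ _] := hM w Uw; have [kw _ _] := kN w Uw.
have d0 := rnorm_ge0 (w - z); set d := rnorm (w - z) in d0 h4 h5 k4 k5 *.
have e0 : 0 <= M * N * d by rewrite mulr_ge0.
have e1 : 0 <= M * N * d ^+ 2 by rewrite mulr_ge0 ?exprn_ge0.
split.
  have -> : h w * k w - h z * k z = (h w - h z) * k w + h z * (k w - k z) by ring.
  have := bd _ _ _ _ h4 kw; have := bd _ _ _ _ h1 k4.
  have := ler_rnormD ((h w - h z) * k w : R[i]) (h z * (k w - k z)).
  by nra.
have -> : h w * k w - h z * k z - (h' z * k z + h z * k' z) * (w - z) =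
    (h w - h z - h' z * (w - z)) * k w + (h' z * (w - z)) * (k w - k z)
    + h z * (k w - k z - k' z * (w - z)) by ring.
have := bd _ _ _ _ h5 kw; have := bd _ _ _ _ h1 k5.
have := bd _ _ _ _ (bd _ _ _ _ h2 (lexx (rnorm (w - z)))) k4.
rewrite -/d => c1 c2 c3.
apply: le_trans (ler_rnormD _ _) _.
apply: le_trans (lerD (ler_rnormD _ _) (lexx _)) _; nra.
Qed.

Lemma uniformly_differentiableX U h n : uniformly_differentiable U h ->
  uniformly_differentiable U (fun z => h z ^+ n).
Proof.
move=> hU; elim: n => [|n IH]; first exact: uniformly_differentiable_cst.
have -> : (fun z => h z ^+ n.+1) = (fun z => h z * h z ^+ n).
  by apply: funext => z; rewrite exprS.
exact: uniformly_differentiableM.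
Qed.

Lemma uniformly_differentiableV U a (r : R) : 0 < r ->
  (forall z, U z -> r <= rnorm (z - a)) ->
  uniformly_differentiable U (fun z => (z - a)^-1).
Proof.
move=> r0 Ur; pose q := r^-1; have q0 : 0 < q by rewrite invr_gt0.
have za z : U z -> z - a != 0.
  by move=> /Ur rz; rewrite -rnorm_eq0; apply: lt0r_neq0; exact: lt_le_trans rz.
have zq z : U z -> rnorm (z - a)^-1 <= q.
  by move=> Uz; rewrite rnormV lef_pV2 ?posrE ?Ur // (lt_le_trans r0) ?Ur.
have [q1 q2 q3] : [/\ q <= 1 + q + q ^+ 2 + q ^+ 3,
    q ^+ 2 <= 1 + q + q ^+ 2 + q ^+ 3 & q ^+ 3 <= 1 + q + q ^+ 2 + q ^+ 3].
  by have := exprn_gt0 2 q0; have := exprn_gt0 3 q0; split; lra.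
have bd (u v : R[i]) (A B : R) : rnorm u <= A -> rnorm v <= B ->
    rnorm (u * v) <= A * B.
  by move=> uA vB; rewrite rnormM ler_pM ?rnorm_ge0.
(* The value, the derivative and the coefficient of the remainder are bounded by q, q^2 and q^3; the
   constant dominates all three. *)
exists (fun z => - (z - a)^-1 ^+ 2), (1 + q + q ^+ 2 + q ^+ 3).
split=> [|z Uz]; first by apply: le_trans q1; exact: ltW.
split; first exact: le_trans (zq z Uz) q1.
  rewrite rnormN rnormX; apply: le_trans q2.
  by rewrite ler_pXn2r ?nnegrE ?rnorm_ge0 ?zq // ltW.
move=> w Uw; have := za z Uz; have := za w Uw => wa0 za0.
have zw : rnorm ((z - a)^-1 * (w - a)^-1) <= q ^+ 2.
  by rewrite expr2; apply: bd; exact: zq.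
split.
  have -> : (w - a)^-1 - (z - a)^-1 = ((z - a)^-1 * (w - a)^-1) * - (w - z).
    by field; rewrite wa0 za0.
  by rewrite rnormM rnormN ler_wpM2r ?rnorm_ge0 // (le_trans zw).
have -> : (w - a)^-1 - (z - a)^-1 - - (z - a)^-1 ^+ 2 * (w - z) =
   ((z - a)^-1 * ((z - a)^-1 * (w - a)^-1)) * (w - z) ^+ 2.
  by field; rewrite wa0 za0.
rewrite rnormM rnormX ler_wpM2r ?exprn_ge0 ?rnorm_ge0 //.
by apply: le_trans q3; rewrite exprS; apply: bd => //; exact: zq.
Qed.

Lemma uniformly_differentiable_sub (U W : set R[i]) h : W `<=` U ->
  uniformly_differentiable U h -> uniformly_differentiable W h.
Proof.
move=> WU [h' [M [M0 hM]]]; exists h', M; split=> // z /WU/hM[h1 h2 h3].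
by split=> // w /WU/h3.
Qed.

Lemma square_sum_uniformly_differentiable U h : uniformly_differentiable U h ->
  exists2 M : R, 0 <= M & forall n p s, 0 <= s -> square p s `<=` U ->
    rnorm (square_sum n p s h) <= M * s ^+ 3 / 2 ^+ n.
Proof.
move=> [h' [M [M0 hM]]]; exists (2 * M) => [|n p s s0 pU].
  by rewrite mulr_ge0.
apply: square_cauchy s0 _ => z w /pU Uz /pU Uw.
by have [_ _ h3] := hM z Uz; have [_] := h3 w Uw; exact.
Qed.

End UniformlyDifferentiable.

(** * A contour around part of a compact set *)

Section SeparatingContour.
Variable R : realType.
Variables (S S1 : set R[i]) (l : R[i]) (eps M : R).
Hypothesis S1S : S1 `<=` S.
Hypothesis S1l : S1 l.
Hypothesis SM : forall z, S z -> rnorm z <= M.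
Hypothesis eps0 : 0 < eps.
Hypothesis S1_separated :
  forall z w, S1 z -> S w -> rnorm (z - w) < eps -> S1 w.

(** With this side a square that meets S1 stays within eps of S1. The offsets make l the centre of
    square (m, m), and m is large enough for the grid to cover S1 with a margin. *)
Let s := eps / 4.
Let r := s / 2.
Let m := Num.bound `|(2 * M + s) / s|.
Let N := (2 * m)%N.
Let corner (i j : nat) : R[i] :=
  l - ((m%:R * s + r) +i* (m%:R * s + r)) + ((i%:R * s) +i* (j%:R * s)).
Let hit p := `[< exists2 u, S1 u & square p s u >].
Let chi i j : R[i] := (hit (corner i j))%:R.
(** The weight carries the jump of [chi] across the edge, with the sign of the counterclockwise
    boundary; it is 0 unless exactly one of the two adjacent squares meets S1. *)
Let hedge i j := (corner i j.+1, s%:C, (chi i j.+1 - chi i j) * s%:C).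
Let vedge i j :=
  (corner i.+1 j, 'i * s%:C, (chi i j - chi i.+1 j) * ('i * s%:C)).
(* The boundary of the union of the squares of a grid that meet S1. *)
Let E := [seq e <- [seq hedge i j | i <- index_iota 0 N, j <- index_iota 0 N] ++
                   [seq vedge i j | i <- index_iota 0 N, j <- index_iota 0 N]
           | e.2 != 0].

Let s0 : 0 < s. Proof. by rewrite divr_gt0. Qed.

Let m_large : 2 * M + s < m%:R * s.
Proof.
rewrite -ltr_pdivrMr //; apply: le_lt_trans (ler_norm _) _.
apply: archi_boundP; exact: normr_ge0.
Qed.

Let corner_mm : corner m m = l - (r +i* r).
Proof.
rewrite /corner; case: l => x y; apply/eqP; rewrite eq_complex /=.
by apply/andP; split; apply/eqP; ring.
Qed.

Let cornerH i j : corner i j + s%:C = corner i.+1 j.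
Proof.
rewrite /corner -addrA; congr (_ + _); apply/eqP; rewrite eq_complex /=.
by rewrite -natr1 addr0 eqxx andbT mulrDl mul1r.
Qed.

Let cornerV i j : corner i j + 'i * s%:C = corner i j.+1.
Proof.
rewrite /corner -addrA; congr (_ + _); apply/eqP; rewrite eq_complex /=.
rewrite -natr1; apply/andP; split; apply/eqP; ring.
Qed.

Let cornerB i j z : z - corner i j =
  (complex.Re (z - l) + m%:R * s + r - i%:R * s) +i*
  (complex.Im (z - l) + m%:R * s + r - j%:R * s).
Proof.
rewrite /corner; case: z => z1 z2; case: l => x y; apply/eqP.
by rewrite eq_complex /=; apply/andP; split; apply/eqP; ring.
Qed.

Let grid_bound (x : R) i : `|x| <= 2 * M ->
  0 <= x + m%:R * s + r - i%:R * s <= s -> (0 < i < N)%N.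
Proof.
rewrite ler_norml => /andP[x1 x2] /andP[h1 h2]; have hm := m_large.
have s0' := s0.
apply/andP; split; first by case: i h2 {h1} => //; rewrite mul0r /r; lra.
rewrite ltnNge; apply/negP => Ni.
have : N%:R * s <= i%:R * s by rewrite ler_wpM2r ?ler_nat // ltW.
by rewrite /N natrM; move: h1; rewrite /r; lra.
Qed.

(** The strict bounds make [chi] vanish at the indices 0 and N, which removes the boundary terms in
    [summation_by_parts]. *)
Let hit_range i j : hit (corner i j) -> (0 < i < N)%N && (0 < j < N)%N.
Proof.
move=> /asboolP[u S1u]; rewrite /square /= cornerB /= => /andP[h1 h2].
have ul : rnorm (u - l) <= 2 * M.
  apply: le_trans (ler_rnormD _ _) _; rewrite rnormN.
  by have := SM (S1S S1u); have := SM (S1S S1l); lra.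
apply/andP; split.
  by apply: grid_bound h1; exact: le_trans (ler_Re_rnorm _) ul.
by apply: grid_bound h2; exact: le_trans (ler_Im_rnorm _) ul.
Qed.

Let chi_out i j : ~~ ((0 < i < N)%N && (0 < j < N)%N) -> chi i j = 0.
Proof. by rewrite /chi; case: (boolP (hit _)) => // /hit_range ->. Qed.

Let hit_mm : hit (corner m m).
Proof.
apply/asboolP; exists l => //; rewrite /square /= corner_mm opprB addrC subrK /=.
by have := s0; rewrite /r => ?; apply/andP; split; apply/andP; split; lra.
Qed.

Let square_near p z : hit p -> square p s z ->
  exists2 u, S1 u & rnorm (z - u) < eps.
Proof.
move=> /asboolP[u S1u pu] pz; exists u => //.
by apply: le_lt_trans (square_diam pz pu) _; rewrite /s; have := eps0; lra.
Qed.

(** A point z of S in p would be within eps of S1, hence in S1 by separation, and then q would meet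
    S1 too. *)
Let edge_avoids p q z : square p s z -> square q s z -> hit p -> ~~ hit q ->
  ~ S z.
Proof.
move=> pz qz hp /negP hq Sz; apply: hq; apply/asboolP; exists z => //.
have [u S1u uz] := square_near hp pz.
by apply: (S1_separated S1u Sz); rewrite rdistC.
Qed.

Let edge_ok p q z : square p s z -> square q s z ->
  (hit p)%:R - (hit q)%:R != 0 :> R[i] ->
  ~ S z /\ exists2 u, S1 u & rnorm (z - u) < eps.
Proof.
move=> pz qz; case: (boolP (hit p)) => hp; case: (boolP (hit q)) => hq.
- by rewrite subrr eqxx.
- by move=> _; split; [exact: edge_avoids pz qz hp hq|exact: square_near hp pz].
- by move=> _; split; [exact: edge_avoids qz pz hq hp|exact: square_near hq qz].
- by rewrite subrr eqxx.
Qed.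

Let segH i j z : segment (corner i j) s%:C z -> square (corner i j) s z.
Proof.
move=> [t /andP[t0 t1] ->]; rewrite /square /= addrC addKr /=.
have := s0 => ?; have := mulr_ge0 t0 (ltW s0); have : t * s <= s by rewrite ger_pMl.
by move=> ? ?; apply/andP; split; apply/andP; split; lra.
Qed.

Let segH' i j z : segment (corner i j.+1) s%:C z -> square (corner i j) s z.
Proof.
move=> [t /andP[t0 t1] ->]; rewrite /square /= -cornerV -[_ + _ + _%:C * _]addrA [_ - corner i j]addrC addKr /=.
have := s0 => ?; have := mulr_ge0 t0 (ltW s0); have : t * s <= s by rewrite ger_pMl.
by move=> ? ?; apply/andP; split; apply/andP; split; lra.
Qed.

Let segV i j z : segment (corner i j) ('i * s%:C) z -> square (corner i j) s z.
Proof.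
move=> [t /andP[t0 t1] ->]; rewrite /square /= addrC addKr /=.
have := s0 => ?; have := mulr_ge0 t0 (ltW s0); have : t * s <= s by rewrite ger_pMl.
by move=> ? ?; apply/andP; split; apply/andP; split; lra.
Qed.

Let segV' i j z : segment (corner i.+1 j) ('i * s%:C) z -> square (corner i j) s z.
Proof.
move=> [t /andP[t0 t1] ->]; rewrite /square /= -cornerH -[_ + _ + _%:C * _]addrA [_ - corner i j]addrC addKr /=.
have := s0 => ?; have := mulr_ge0 t0 (ltW s0); have : t * s <= s by rewrite ger_pMl.
by move=> ? ?; apply/andP; split; apply/andP; split; lra.
Qed.

Let support_ok z : contour_support E z ->
  ~ S z /\ exists2 u, S1 u & rnorm (z - u) < eps.
Proof.
move=> [e]; rewrite mem_filter mem_cat => /andP[e0 /orP[]].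
  move=> /allpairsP[[i j] [_ _ eE]]; move: e0; rewrite eE /= mulf_eq0 negb_or.
  move=> /andP[c0 _] hz; exact: edge_ok (segH hz) (segH' hz) c0.
move=> /allpairsP[[i j] [_ _ eE]]; move: e0; rewrite eE /= mulf_eq0 negb_or.
move=> /andP[c0 _] hz; exact: edge_ok (segV' hz) (segV hz) c0.
Qed.

Let summation_by_parts (c H : nat -> R[i]) : c 0%N = 0 -> c N = 0 ->
  \sum_(0 <= j < N) (c j.+1 - c j) * H j.+1 =
  \sum_(0 <= j < N) c j * (H j - H j.+1).
Proof.
move=> c0 cN; apply/subr0_eq; rewrite -sumrB.
rewrite (eq_bigr (fun j => c j.+1 * H j.+1 - c j * H j)); last first.
  by move=> j _; ring.
by rewrite (telescope_sumr (fun j => c j * H j)) // c0 cN !mul0r subrr.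
Qed.

(** A discrete Green formula: summation by parts in each direction moves the differences from [chi]
    to the edge sums, which assemble into [square_sum]. *)
Let contour_sum_squares n (h : R[i] -> R[i]^o) : contour_sum E n h =
  \sum_(0 <= i < N) \sum_(0 <= j < N) chi i j * square_sum n (corner i j) s h.
Proof.
pose H i j := s%:C * segment_sum n (corner i j) s%:C h.
pose V i j := ('i * s%:C) * segment_sum n (corner i j) ('i * s%:C) h.
have -> : contour_sum E n h =
    \sum_(0 <= i < N) \sum_(0 <= j < N) (chi i j.+1 - chi i j) * H i j.+1 +
    \sum_(0 <= i < N) \sum_(0 <= j < N) (chi i j - chi i.+1 j) * V i.+1 j.
  rewrite /contour_sum big_filter big_mkcond /=.
  transitivity (\sum_(e <- [seq hedge i j | i <- index_iota 0 N, j <- index_iota 0 N] ++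
      [seq vedge i j | i <- index_iota 0 N, j <- index_iota 0 N])
      e.2 *: segment_sum n e.1.1 e.1.2 h).
    by apply: eq_bigr => e _; case: eqP => //= ->; rewrite scale0r.
  rewrite big_cat !big_allpairs_dep; congr (_ + _); apply: eq_bigr => i _;
    apply: eq_bigr => j _; by rewrite /H /V mulrA.
have -> : \sum_(0 <= i < N) \sum_(0 <= j < N) (chi i j - chi i.+1 j) * V i.+1 j =
    \sum_(0 <= i < N) \sum_(0 <= j < N) chi i j * (V i.+1 j - V i j).
  rewrite exchange_big [RHS]exchange_big; apply: eq_bigr => j _ /=.
  have := @summation_by_parts (fun i => - chi i j) (fun i => V i j).
  rewrite !chi_out ?ltnn ?andbF ?oppr0 // => /(_ erefl erefl) e.
  transitivity (\sum_(0 <= i < N) (- chi i.+1 j - - chi i j) * V i.+1 j).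
    by apply: eq_bigr => i _; ring.
  by rewrite e; apply: eq_bigr => i _; ring.
rewrite -big_split; apply: eq_bigr => i _.
rewrite summation_by_parts ?chi_out ?ltnn ?andbF // -big_split.
apply: eq_bigr => j _; rewrite /square_sum cornerH cornerV -/(H _ _) -/(V _ _).
by rewrite -/(H _ _) -/(V _ _) /=; ring.
Qed.

Let contour_cauchy (h : R[i] -> R[i]^o) :
  uniformly_differentiable [set z | exists2 u, S1 u & rnorm (z - u) < eps] h ->
  contour_integral E h 0.
Proof.
move=> /square_sum_uniformly_differentiable[K K0 hK].
exists (\sum_(0 <= i < N) \sum_(0 <= j < N) (K * s ^+ 3)) => n.
rewrite subr0 contour_sum_squares mulr_suml.
apply: le_trans (ler_rnorm_sum _ _ _) (ler_sum _ _) => i _; rewrite mulr_suml.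
apply: le_trans (ler_rnorm_sum _ _ _) (ler_sum _ _) => j _.
rewrite /chi; case: (boolP (hit _)) => hp; last first.
  by rewrite mul0r rnorm0 !mulr_ge0 ?invr_ge0 ?exprn_ge0 // ltW.
rewrite mul1r; apply: hK; first exact: ltW.
by move=> z; exact: square_near hp.
Qed.

Let square_away i j : (i != m) || (j != m) ->
  square (corner i j) s `<=` [set z | r <= rnorm (z - l)].
Proof.
have away (x : R) k : k != m -> 0 <= x + m%:R * s + r - k%:R * s <= s -> r <= `|x|.
  move=> km /andP[h1 h2]; have [km'|mk] := ltnP k m.
    have : (k.+1)%:R * s <= m%:R * s by rewrite ler_wpM2r ?ler_nat // ltW.
    by rewrite -natr1; move: h1 h2; rewrite /r; have := s0; case: (ler0P x); lra.
  have : (m.+1)%:R * s <= k%:R * s.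
    by rewrite ler_wpM2r ?ler_nat ?(ltW s0) // ltn_neqAle eq_sym km.
  by rewrite -natr1; move: h1 h2; rewrite /r; have := s0; case: (ler0P x); lra.
move=> ij z; rewrite /square /= cornerB /= => /andP[h1 h2].
have [im|jm] := orP ij.
  by apply: le_trans (ler_Re_rnorm _); exact: away im h1.
by apply: le_trans (ler_Im_rnorm _); exact: away jm h2.
Qed.

(** The square centred at l contributes at least 4. The others keep distance r from l, where 1 / (z
    - l) is uniformly differentiable, so their total contribution is O(2^-n). *)
Let contour_winding : exists C : R, forall n,
  4 - C / 2 ^+ n <= complex.Im (contour_sum E n (fun z => (z - l)^-1 : R[i]^o)).
Proof.
have r0 : 0 < r by rewrite divr_gt0.
have [K K0 hK] := square_sum_uniformly_differentiable
  (uniformly_differentiableV r0 (fun z h => h : [set z | r <= rnorm (z - l)] z)).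
pose D := K * s ^+ 3; have D0 : 0 <= D by rewrite mulr_ge0 // exprn_ge0 // ltW.
exists (\sum_(0 <= i < N) \sum_(0 <= j < N) D) => n.
have Dn : 0 <= D / 2 ^+ n by rewrite divr_ge0 // exprn_ge0.
have Im_sum (F : nat -> R[i]) k :
    complex.Im (\sum_(0 <= i < k) F i) = \sum_(0 <= i < k) complex.Im (F i).
  rewrite !big_mkord; elim: k => [|k IH]; rewrite ?big_ord0 // !big_ord_recr /= -IH.
  by case: (\sum_(_ < _) _); case: (F k).
have m0 : (m < N)%N.
  by have := hit_range hit_mm => /andP[/andP[]].
rewrite contour_sum_squares Im_sum.
apply: le_trans (_ : \sum_(0 <= i < N) \sum_(0 <= j < N)
    ((if i == m then if j == m then 4 else 0 else 0) - D / 2 ^+ n) <= _).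
  rewrite le_eqVlt; apply/orP; left; apply/eqP.
  rewrite mulr_suml -[4 in LHS](_ : \sum_(0 <= i < N)
    \sum_(0 <= j < N) (if i == m then if j == m then 4 else 0 else 0) = 4).
    rewrite -sumrB; apply: eq_bigr => i _.
    by rewrite mulr_suml -sumrB.
  rewrite (eq_bigr (fun i => if i == m then 4 else 0)); last first.
    move=> i _; case: eqP => _; last by rewrite big1.
    by rewrite -big_mkcond big_nat1_eq m0.
  by rewrite -big_mkcond big_nat1_eq m0.
apply: ler_sum => i _; rewrite Im_sum; apply: ler_sum => j _.
have [/andP[/eqP -> /eqP ->]|] := boolP ((i == m) && (j == m)).
  rewrite !eqxx /chi hit_mm mul1r corner_mm.
  by have := square_winding n l s0; rewrite -/r; lra.
rewrite negb_and => ij.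
have -> : (if i == m then if j == m then 4 else 0 else 0) = 0 :> R.
  by move: ij; case: eqP; case: eqP.
rewrite sub0r; have := hK n (corner i j) s (ltW s0) (square_away ij).
rewrite /chi; case: (hit _) => h; last by rewrite mul0r /= oppr_le0.
rewrite mul1r; have := ler_Im_rnorm (square_sum n (corner i j) s
  (fun z => (z - l)^-1 : R[i]^o)).
by rewrite ler_norml => /andP[+ _]; apply: le_trans; rewrite lerN2.
Qed.

Lemma separating_contour : exists E : seq (R[i] * R[i] * R[i]),
  [/\ forall z, contour_support E z ->
        ~ S z /\ exists2 u, S1 u & rnorm (z - u) < eps,
      forall h : R[i] -> R[i]^o,
        uniformly_differentiable [set z | exists2 u, S1 u & rnorm (z - u) < eps] h ->
        contour_integral E h 0
    & exists C : R, forall n, 4 - C / 2 ^+ n <=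
        complex.Im (contour_sum E n (fun z => (z - l)^-1 : R[i]^o))].
Proof. by exists E; split; [exact: support_ok|exact: contour_cauchy|]. Qed.

End SeparatingContour.

(** * Weak density *)

Section WeakDensity.
Variable R : realType.

Lemma open_rball (c : R[i]^o) (e : R) : open [set w : R[i]^o | rnorm (w - c) < e].
Proof.
rewrite openE => w /= wc; apply/rnbhsP; exists (e - rnorm (w - c)).
  by rewrite subr_gt0.
move=> v wv; apply: le_lt_trans (ler_rdistD w _ _) _.
by rewrite (rdistC v); move: wv; rewrite ltrBrDr.
Qed.

Lemma weak_open_preimage (V : normedModType R[i]) (f : {linear V -> R[i]^o})
    (A : set R[i]^o) :
  bounded_operator f -> open A -> @open (weak_space V) (f @^-1` A).
Proof.
move=> bf oA; rewrite openE => y /= Ay.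
have [H _] := @cvg_sup V (topological_dual V) (fun f : topological_dual V =>
    Topological.on (initial_topology (sval f : V -> R[i]^o)))
    (nbhs (y : weak_space V)) y _.
apply: (H cvg_id (exist _ f bf)).
have /= := @initial_continuous V R[i]^o f y A; apply.
by apply: open_nbhs_nbhs.
Qed.

(** The form in which weak density is used: a single iterate serves all k functionals at once. *)
Lemma weakly_hypercyclic_approx (V : normedModType R[i]) (T : V -> V) (x : V)
    (k : nat) (phi : 'I_k -> {linear V -> R[i]^o}) (y : V) (e : R) :
  weakly_hypercyclic_vector T x -> (forall j, bounded_operator (phi j)) -> 0 < e ->
  exists n, forall j, rnorm (phi j (iter n T x) - phi j y) < e.
Proof.
move=> whc bphi e0.
pose A := [set u : weak_space V | forall j, rnorm (phi j u - phi j y) < e].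
have [||u [Au [n _ nu]]] := whc A; last by exists n; rewrite nu.
- by exists y => j; rewrite subrr rnorm0.
- rewrite openE => u Au; rewrite /interior.
  have : forall s : seq 'I_k, nbhs (u : weak_space V)
      [set v : weak_space V | forall j, j \in s -> rnorm (phi j v - phi j y) < e].
    elim=> [|j s IH]; first by apply: filterS filterT.
    have oj := weak_open_preimage (bphi j) (@open_rball (phi j y) e).
    have : nbhs (u : weak_space V) (phi j @^-1` [set w | rnorm (w - phi j y) < e]).
      by apply: open_nbhs_nbhs; split=> //; exact: Au.
    move=> /filterI/(_ IH); apply: filterS => v [h1 h2] i.
    by rewrite inE => /predU1P[->|ij]; [exact: h1|exact: h2].
  move=> /(_ (enum 'I_k)); apply: filterS => v h j; apply: h.
  by rewrite mem_enum.

Qed.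

End WeakDensity.

(** * Riesz operators *)

Section RieszOperators.
Variables (R : realType) (X : completeNormedModType R[i]) (T : {linear X -> X}).
Implicit Types (E : seq (R[i] * R[i] * R[i])).

(** Near each point of the segment the resolvent bound at most doubles; compactness of [0, 1] turns
    the local bounds into one. *)
Lemma resolvent_bound_segment a d :
  (forall z, segment a d z -> ~ spectrum T z) ->
  exists M : R, forall z, segment a d z -> exists2 S, resolvent T z S &
    forall x, rnorm (S x) <= M * rnorm x.
Proof.
move=> hz.
have /compact_near_coveringP cK := @segment_compact R 0 1.
have : \forall M \near (+oo : set_system R), `[0, 1]%classic `<=` [set t : R | exists2 S,
    resolvent T (a + t%:C * d) S & forall x, rnorm (S x) <= M * rnorm x].
  apply: (cK R +oo (fun M t => exists2 S,
    resolvent T (a + t%:C * d) S & forall x, rnorm (S x) <= M * rnorm x)) => t.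
  rewrite /= in_itv /= => t01.
  have /spectrumPn[S [M M0 [hS hM]]] : ~ spectrum T (a + t%:C * d).
    by apply: hz; exists t.
  (* This radius ensures |t - u| |d| M <= 1/2, as [resolvent_perturbation] asks; the + 1 covers d =
     0. *)
  pose e := (2 * M * (rnorm d + 1))^-1.
  have d1 : 0 < rnorm d + 1 by rewrite ltr_wpDl ?rnorm_ge0.
  have e0 : 0 < e by rewrite invr_gt0 !mulr_gt0.
  exists (ball t e, [set N | 2 * M < N]).
    by split; [exact: nbhsx_ballx|apply: nbhs_pinfty_gt; exact: num_real].
  case=> u N [/= tu MN].
  have [|S' hS' hN] := @resolvent_perturbation R X T _ (a + u%:C * d) S M hS hM.
    rewrite opprD addrACA subrr add0r -mulrBl rnormM -rmorphB rnorm_real distrC.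
    move: tu; rewrite -ball_normE /ball_ /= => tu.
    have : `|t - u| * (rnorm d + 1) * M <= e * (rnorm d + 1) * M.
      by rewrite ler_wpM2r ?(ltW M0) // ler_wpM2r ?(ltW d1) // ltW.
    rewrite /e -[X in X <= _]mulrA [X in _ -> X <= _]mulrAC.
    have -> : (2 * M * (rnorm d + 1))^-1 * (rnorm d + 1) * M = 2^-1.
      by field; rewrite !lt0r_neq0.
    apply: le_trans; rewrite -mulrA ler_wpM2l //; have := rnorm_ge0 d; nra.
  exists S' => // x; apply: le_trans (hN x) _.
  by rewrite ler_wpM2r ?rnorm_ge0 // ltW.
move=> [M [_ hM]]; exists (M + 1) => z [t t01 ->].
by apply: (hM (M + 1)); rewrite ?ltrDl //= in_itv.
Qed.

Lemma resolvent_bound_contour E :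
  (forall z, contour_support E z -> ~ spectrum T z) ->
  exists (S : R[i] -> {linear X -> X}) (M : R), 0 < M /\
    forall z, contour_support E z -> resolvent T z (S z) /\
      forall x, rnorm (S z x) <= M * rnorm x.
Proof.
move=> hE.
have [M M0 hM] : exists2 M : R, 0 < M & forall z, contour_support E z ->
    exists2 S, resolvent T z S & forall x, rnorm (S x) <= M * rnorm x.
  elim: E hE => [|e E IH] hE; first by exists 1 => // z [].
  have [z [e' e'E h]|M M0 hM] := IH.
    by apply: hE; exists e' => //; rewrite inE e'E orbT.
  have [z ez|N hN] := @resolvent_bound_segment e.1.1 e.1.2.
    by apply: hE; exists e => //; rewrite inE eqxx.
  exists (M + `|N|) => [|z [e']]; first by rewrite ltr_pwDl.
  rewrite inE => /predU1P[->|e'E] ez.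
    have [S hS bS] := hN z ez; exists S => // x; apply: le_trans (bS x) _.
    by rewrite ler_wpM2r ?rnorm_ge0 // (le_trans (ler_norm N)) // lerDr ltW.
  have [|S hS bS] := hM z; first by exists e'.
  exists S => // x; apply: le_trans (bS x) _.
  by rewrite ler_wpM2r ?rnorm_ge0 // lerDl.
have [z|S hS] := @choice R[i] {linear X -> X} (fun z S => contour_support E z ->
    resolvent T z S /\ forall x, rnorm (S x) <= M * rnorm x).
  have [/hM[S hS bS]|nz] := pselect (contour_support E z); first by exists S.
  (* A default value off the contour. *)
  by exists T.
by exists S, M.
Qed.

Variable E : seq (R[i] * R[i] * R[i]).
Variables (S : R[i] -> {linear X -> X}) (M : R).
Hypothesis T_bounded : bounded_operator T.
Hypothesis M0 : 0 < M.
Hypothesis S_resolvent : forall z, contour_support E z -> resolvent T z (S z).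
Hypothesis S_bound : forall z x, contour_support E z -> rnorm (S z x) <= M * rnorm x.

Let smooth (h : R[i] -> R[i]^o) := uniformly_differentiable (contour_support E) h.

(* The operator h(T) of the holomorphic functional calculus, without the factor
   1 / (2 pi i) and up to sign: [S z] is the inverse of T - z. *)
Definition riesz (h : R[i] -> R[i]^o) (x : X) : X :=
  xget 0 [set y | contour_integral E (fun z => h z *: S z x) y].

(** By the resolvent identity z -> S z is Lipschitz with constant M^2 on the contour. *)
Lemma scaled_resolvent_lipschitz h x : smooth h -> exists L : R,
  forall z w, contour_support E z -> contour_support E w ->
    rnorm (h z *: S z x - h w *: S w x) <= L * rnorm (z - w).
Proof.
move=> [h' [A [A0 hA]]]; exists (A * M * rnorm x + A * (M * M * rnorm x)).
move=> z w Ez Ew; have [hw _ /(_ z Ez)[hzw _]] := hA w Ew.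
have -> : h z *: S z x - h w *: S w x =
    (h z - h w) *: S z x + h w *: (S z x - S w x).
  by rewrite scalerBl scalerBr addrA subrK.
apply: le_trans (ler_rnormD _ _) _; rewrite !rnormZ mulrDl; apply: lerD.
  have -> : A * M * rnorm x * rnorm (z - w) = A * rnorm (z - w) * (M * rnorm x).
    by ring.
  by apply: ler_pM; rewrite ?rnorm_ge0 // S_bound.
rewrite -mulrA; apply: ler_pM; rewrite ?rnorm_ge0 //.
rewrite (resolvent_identity (S_resolvent Ez) (S_resolvent Ew)) rnormZ mulrC.
rewrite ler_wpM2r ?rnorm_ge0 //; apply: le_trans (S_bound _ Ez) _.
by rewrite -mulrA ler_pM2l //; exact: S_bound.
Qed.

Lemma riesz_integral h x : smooth h ->
  contour_integral E (fun z => h z *: S z x) (riesz h x).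
Proof.
move=> /(scaled_resolvent_lipschitz x)[L /contour_integral_ex[y hy]].
exact: (xgetPex 0 (ex_intro _ y hy)).
Qed.

Lemma rieszE h x y : smooth h ->
  contour_integral E (fun z => h z *: S z x) y -> riesz h x = y.
Proof. by move=> /(riesz_integral x); exact: contour_integral_unique. Qed.

Lemma eq_riesz h k x : smooth h -> smooth k ->
  (forall z, contour_support E z -> h z = k z) -> riesz h x = riesz k x.
Proof.
move=> hs ks hk; apply: rieszE => //.
apply: eq_contour_integral (riesz_integral x ks) => z Ez.
by rewrite hk.
Qed.

Lemma riesz_linear h : smooth h -> linear (riesz h).
Proof.
move=> hs a x y; apply: rieszE => //.
apply: eq_contour_integral (contour_integralP a (riesz_integral x hs)
  (riesz_integral y hs)) => z _.
by rewrite linearP scalerDr !scalerA mulrC.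
Qed.

Lemma rnorm_riesz h (B : R) x : smooth h ->
  (forall z, contour_support E z -> rnorm (h z) <= B) ->
  rnorm (riesz h x) <= contour_weight E * (B * (M * rnorm x)).
Proof.
move=> hs hB; apply: rnorm_contour_integral (riesz_integral x hs) => z Ez.
by rewrite rnormZ ler_pM ?rnorm_ge0 ?hB ?S_bound.
Qed.

Lemma riesz_bounded h : smooth h ->
  exists2 B : R, 0 < B & forall x, rnorm (riesz h x) <= B * rnorm x.
Proof.
move=> hs; have [h' [B [B0 hB]]] := hs.
have W0 : 0 <= contour_weight E by apply: sumr_ge0 => e _; exact: rnorm_ge0.
exists (contour_weight E * (B * M) + 1) => [|x].
  by rewrite ltr_wpDl // !mulr_ge0 // ltW.
apply: le_trans (@rnorm_riesz h B x hs _) _; first by move=> z /hB[].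
by rewrite mulrDl mul1r !mulrA lerDl rnorm_ge0.
Qed.

Lemma riesz_commutes h x : smooth h -> riesz h (T x) = T (riesz h x).
Proof.
move=> hs; apply: rieszE => //.
apply: eq_contour_integral (contour_integral_map T_bounded (riesz_integral x hs)).
by move=> z Ez; rewrite linearZ /= (resolvent_commutes x (S_resolvent Ez)).
Qed.

(** S z T = 1 + z S z, and integrating h times the term 1 gives c. *)
Lemma riesz_mul h c x : smooth h -> smooth (fun z => h z * z) ->
  contour_integral E h c ->
  riesz h (T x) = c *: x + riesz (fun z => h z * z) x.
Proof.
move=> hs hs' hc; apply: rieszE => //.
have := contour_integralP 1 (contour_integralZ x hc) (riesz_integral x hs').
rewrite !scale1r; apply: eq_contour_integral => z Ez.
have [ST _] := S_resolvent Ez; rewrite scale1r -{1}(ST x) linearB linearZ /=.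
by rewrite scalerBr scalerA subrK.
Qed.

(** Meant for h z = 1 / (z - a), where z h z = 1 + a h z. *)
Lemma riesz_shift h a x : smooth h -> smooth (fun z => h z * z) ->
  smooth (fun z => 1) -> (forall z, contour_support E z -> h z * z = 1 + a * h z) ->
  riesz (fun z => h z * z) x = riesz (fun z => 1) x + a *: riesz h x.
Proof.
move=> hs hs' s1 e; apply: rieszE => //; rewrite addrC.
apply: eq_contour_integral (contour_integralP a (riesz_integral x hs)
  (riesz_integral x s1)) => z Ez.
by rewrite e // scalerDl scalerA addrC.
Qed.

(* If the Riesz operator of the constant 1 vanishes, then the one of 1 / (z - l)
   is a nonzero multiple of the inverse of T - l. *)
Lemma riesz1_neq0 l (B : R) : (exists v : X, v != 0) -> spectrum T l ->
  (forall z, contour_support E z -> rnorm z <= B) ->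
  (exists C : R, forall n, 4 - C / 2 ^+ n <=
     complex.Im (contour_sum E n (fun z => (z - l)^-1 : R[i]^o))) ->
  exists v, riesz (fun=> 1) v != 0.
Proof.
move=> [v0 v0_neq0] Tl suppB [C hC]; apply: contrapT => hN.
have P0 v : riesz (fun=> 1) v = 0.
  by apply/eqP/negP => /negP h; apply: hN; exists v.
(* A contour point closer than 1 / (2 M) to l would put l in the resolvent set by perturbation. *)
have away z : contour_support E z -> (2 * M)^-1 <= rnorm (z - l).
  move=> Ez; rewrite leNgt; apply/negP => zl.
  have [||S' hS' bS'] := @resolvent_perturbation R X T z l (S z) M (S_resolvent Ez).
  - by move=> x; exact: S_bound.
  - rewrite rdistC; have := ltW zl; rewrite invfM => h.
    by apply: le_trans (ler_wpM2r (ltW M0) h) _; rewrite mulfVK ?gt_eqF.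
  suff : ~ spectrum T l by [].
  by apply/spectrumPn; exists S', (2 * M) => //; rewrite mulr_gt0.
have M20 : 0 < (2 * M)^-1 by rewrite invr_gt0 mulr_gt0.
pose h z : R[i]^o := (z - l)^-1.
have hs : smooth h := uniformly_differentiableV M20 away.
have ids : smooth id := uniformly_differentiable_id suppB.
have hs' : smooth (fun z => h z * z) := uniformly_differentiableM hs ids.
have s1 : smooth (fun=> 1) := uniformly_differentiable_cst _ _.
(* The scalar integral is read off from the X-valued integral of [h z *: v0] through a functional
   that does not vanish at v0. *)
have [c hc] : exists c, contour_integral E h c.
  have [L hL] : exists L : R, forall z w, contour_support E z ->
      contour_support E w -> rnorm (h z *: v0 - h w *: v0) <= L * rnorm (z - w).
    have [h' [A [A0 hA]]] := hs; exists (A * rnorm v0) => z w Ez Ew.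
    rewrite -scalerBl rnormZ mulrAC ler_wpM2r ?rnorm_ge0 //.
    by have [_ _ /(_ z Ez)[]] := hA w Ew.
  have [y hy] := contour_integral_ex hL.
  have [f bf fv0] := exists_functional v0_neq0.
  exists ((f v0)^-1 *: f y); have := contour_integral_map bf hy.
  move=> [K hK]; exists (rnorm (f v0)^-1 * K) => n.
  have -> : contour_sum E n h = (f v0)^-1 *: contour_sum E n (fun z => f (h z *: v0)).
    rewrite (_ : (fun z => f (h z *: v0)) = (fun z => h z *: f v0)); last first.
      by apply: funext => z; rewrite linearZ.
    by rewrite contour_sumZ -[RHS]/(_ * (_ * _)) mulrCA mulVf // mulr1.
  by rewrite -scalerBr -[_ *: _]/(_ * _) rnormM -mulrA ler_wpM2l ?rnorm_ge0.
(* If c = 0 the contour sums tend to 0, while their imaginary parts are at least 4 - C / 2^n. *)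
have c0 : c != 0.
  apply/eqP => c0; have [D hD] := hc.
  have [N hN'] := half_exp_lt (C + D) (ltr01 : 0 < 1 :> R).
  have := hN' N (leqnn N); have := hC N; have := hD N; rewrite c0 subr0.
  have := ler_Im_rnorm (contour_sum E N h); rewrite ler_norml => /andP[_].
  rewrite mulrDl /h; lra.
(* h(T) (T - l) = c + 1(T) + l h(T) - l h(T), and 1(T) = 0 by [P0]. *)
have key x : riesz h (T x - l *: x) = c *: x.
  have lin := riesz_linear hs.
  have -> : T x - l *: x = (- l) *: x + T x by rewrite scaleNr addrC.
  rewrite lin (riesz_mul x hs hs' hc) (riesz_shift (a := l) x hs hs' s1).
    by rewrite P0 add0r scaleNr addrCA [- _ + _]addrC subrr addr0.
  move=> z Ez; rewrite /h; have : z - l != 0.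
    rewrite -rnorm_eq0; apply: lt0r_neq0; exact: lt_le_trans M20 (away z Ez).
  by move=> zl; field.
pose Q : {linear X -> X} := HB.pack (riesz h) (GRing.isLinear.Build _ _ _ _ _ (riesz_linear hs)).
have [K K0 hK] := riesz_bounded hs.
apply: Tl; exists (c^-1 \*: Q); split=> [|x|x] /=.
- apply/bounded_operatorP; exists (rnorm c^-1 * K).
    by rewrite mulr_gt0 // lt_neqAle rnorm_ge0 eq_sym rnorm_eq0 invr_eq0 c0.
  by move=> x /=; rewrite rnormZ -mulrA ler_wpM2l ?rnorm_ge0 ?hK.
- by rewrite key scalerA mulVf // scale1r.
- have : riesz h (T x - l *: x) = T (riesz h x) - l *: riesz h x.
    by rewrite -(riesz_commutes x hs) -[LHS]/(Q _) linearB linearZ.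
  rewrite key => e; rewrite linearZ /= scalerA mulrC -scalerA -scalerBr -e.
  by rewrite scalerA mulVf // scale1r.
Qed.

End RieszOperators.

(** * Escaping orbits *)

Section OrbitEscape.
Variables (R : realType) (X : completeNormedModType R[i]).
Variables (T : X -> X) (x : X) (L : nat -> {linear X -> X}).
Variables (f : {linear X -> R[i]^o}) (F B q : R).
Hypothesis F0 : 0 < F.
Hypothesis f_bound : forall v, rnorm (f v) <= F * rnorm v.
Hypothesis B0 : 0 <= B.
Hypothesis q01 : 0 < q < 1.
Hypothesis L_bound : forall j y, rnorm (L j y) <= B * q ^+ j * rnorm y.
Hypothesis L_iter : forall k j, L (k + j) (iter k T x) = L j x.
Hypothesis fLx : f (L 0 x) != 0.

Let delta := rnorm (f (L 0 x)).

(* Partial sums of a series of operators L (r + m i), whose terms are selected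
   greedily so that f applied to the sum is not small at the (r + m i)-th point
   of the orbit; geometric decay makes the later terms harmless there. *)
Fixpoint greedy_sum (r m n : nat) (v : X) : X :=
  if n is k.+1 then
    if rnorm (f (greedy_sum r m k (iter (r + m * k) T x))) < delta / 2
    then greedy_sum r m k v + L (r + m * k) v else greedy_sum r m k v
  else 0.

Lemma greedy_sum_linear r m n : linear (greedy_sum r m n).
Proof.
elim: n => [|n IH] a u v /=; first by rewrite scaler0 addr0.
by case: ifP => _; rewrite IH ?linearP // scalerDr addrACA.
Qed.

Lemma greedy_sum_step r m n v :
  rnorm (greedy_sum r m n.+1 v - greedy_sum r m n v) <= rnorm (L (r + m * n) v).
Proof.
rewrite /=; case: ifP => _; first by rewrite addrC addKr.
by rewrite subrr rnorm0 rnorm_ge0.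
Qed.

(** If the sum so far is below delta / 2 at this point of the orbit, the new term adds f (L 0 x), of
    modulus delta. *)
Lemma greedy_sum_large r m k :
  delta / 2 <= rnorm (f (greedy_sum r m k.+1 (iter (r + m * k) T x))).
Proof.
rewrite /=; case: ltP => // h.
have := L_iter (r + m * k) 0; rewrite addn0 => ->; rewrite linearD.
have := ler_rnormB (f (L 0 x)) (- f (greedy_sum r m k (iter (r + m * k) T x))).
rewrite opprK rnormN [f (L 0 x) + _]addrC -/delta; lra.
Qed.

(** G is the limit of the greedy sums. At the point r + m k the value is at least delta / 2 after
    step k, and each later term, from step n, is at most F B |x| q^(m (n - k)); these add up to at
    most delta / 4. *)
Lemma escaping_operator r m : q ^+ m <= 2^-1 ->
  2 * (F * B * rnorm x) * q ^+ m <= delta / 4 ->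
  exists G : {linear X -> X}, bounded_operator G /\
    forall k, delta / 4 <= rnorm (f (G (iter (r + m * k) T x))).
Proof.
move=> qm tail; have [q0 q1] := andP q01.
have Q0 : 0 <= q ^+ m by rewrite exprn_ge0 // ltW.
have qm_exp n : (q ^+ m) ^+ n <= (2 ^+ n)^-1.
  by rewrite -exprVn; apply: lerXn2r; rewrite ?nnegrE ?invr_ge0.
have cvg v : exists l, forall n, rnorm (greedy_sum r m n v - l) <= 2 * (B * rnorm v) / 2 ^+ n.
  apply: geometric_cvg => n; apply: le_trans (greedy_sum_step r m n v) _.
  apply: le_trans (L_bound _ _) _; rewrite mulrAC ler_wpM2l ?mulr_ge0 ?rnorm_ge0 //.
  apply: le_trans (qm_exp n); rewrite exprD exprM; apply: ler_piMl; first exact: exprn_ge0.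
  by apply: exprn_ile1; exact: ltW.
have [G hG] := choice cvg.
have Glin : linear G.
  move=> a u v; apply/subr0_eq/(@eq0_le_half_exp R X _ (2 * (B * rnorm (a *: u + v)) +
    rnorm a * (2 * (B * rnorm u)) + 2 * (B * rnorm v))) => n.
  have -> : G (a *: u + v) - (a *: G u + G v) =
      - (greedy_sum r m n (a *: u + v) - G (a *: u + v)) +
      a *: (greedy_sum r m n u - G u) + (greedy_sum r m n v - G v).
    rewrite greedy_sum_linear scalerBr opprB -[RHS]addrA.
    by rewrite [_ - a *: G u + _]addrACA subrKA opprD.
  apply: le_trans (ler_rnormD _ _) _.
  apply: le_trans (lerD (ler_rnormD _ _) (lexx _)) _.
  rewrite [leRHS]mulrDl; apply: lerD; last exact: hG.
  rewrite [leRHS]mulrDl.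
  apply: lerD; first by rewrite rnormN hG.
  by rewrite rnormZ -mulrA ler_wpM2l ?rnorm_ge0.
pose G' : {linear X -> X} := HB.pack G (GRing.isLinear.Build _ _ _ _ G Glin).
exists G'; split.
  apply/bounded_operatorP; exists (2 * B + 1) => [|v].
    by rewrite ltr_wpDl ?mulr_ge0.
  have := hG v 0%N; rewrite /= sub0r rnormN expr0 divr1 => /le_trans; apply.
  by rewrite [leRHS]mulrDl mul1r mulrA lerDl rnorm_ge0.
move=> k; set y := iter _ T x.
(* The factor 1 - 1 / 2^p comes from the partial sums of the geometric series bounding the later
   terms. *)
have large p : delta / 2 - 2 * (F * B * rnorm x) * q ^+ m * (1 - (2 ^+ p)^-1) <=
    rnorm (f (greedy_sum r m (k.+1 + p) y)).
  elim: p => [|p IH].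
    by rewrite addn0 expr0 invr1 subrr mulr0 subr0 greedy_sum_large.
  rewrite addnS; set n := (k.+1 + p)%N in IH *.
  have step : rnorm (f (greedy_sum r m n y) - f (greedy_sum r m n.+1 y)) <=
      (F * B * rnorm x) * q ^+ m * (2 ^+ p)^-1.
    rewrite rdistC -linearB; apply: le_trans (f_bound _) _.
    apply: le_trans (ler_wpM2l (ltW F0) (greedy_sum_step r m n y)) _.
    have -> : (r + m * n = r + m * k + m * p.+1)%N.
      by rewrite /n -addnA -mulnDr addnS addSn.
    rewrite L_iter -!mulrA ler_pM2l //; apply: le_trans (L_bound _ _) _.
    rewrite -mulrA ler_wpM2l // mulrC ler_wpM2l ?rnorm_ge0 //.
    by rewrite exprM exprS ler_wpM2l.
  have := ler_rnormB (f (greedy_sum r m n y))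
    (f (greedy_sum r m n y) - f (greedy_sum r m n.+1 y)).
  rewrite subKr exprS invfM.
  by move: IH step; set u := (2 ^+ p)^-1; set A := F * B * rnorm x * q ^+ m;
    rewrite -[2 * _ * _]mulrA -/A; lra.
apply/ler_addgt0Pr => e e0.
have [N hN] := half_exp_lt (F * (2 * (B * rnorm y))) e0.
have n0 : (N <= k.+1 + N)%N by rewrite leq_addl.
have h1 : rnorm (f (greedy_sum r m (k.+1 + N) y) - f (G y)) <= e.
  rewrite -linearB; apply: le_trans (f_bound _) _; apply: le_trans (ltW (hN _ n0)).
  by rewrite -mulrA ler_pM2l // hG.
have h2 := ler_rnormB (f (greedy_sum r m (k.+1 + N) y)) (f (G y)).
have h3 := ler_rnormB (f (greedy_sum r m (k.+1 + N) y))
  (f (greedy_sum r m (k.+1 + N) y) - f (G y)).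
rewrite subKr in h3.
have h4 := large N.
have : 2 * (F * B * rnorm x) * q ^+ m * (1 - (2 ^+ N)^-1) <= delta / 4.
  apply: le_trans tail; apply: ler_piMr.
    by rewrite !mulr_ge0 ?rnorm_ge0 // ltW.
  by rewrite gerBl invr_ge0 exprn_ge0.
rewrite -[G' y]/(G y); lra.
Qed.

(** Euclidean division writes each n as r + m k with r < m, so at every point of the orbit one of
    the m functionals f G_r is at least delta / 4, and 0 cannot be approximated. *)
Lemma escaping_orbit_not_weakly_dense : ~ weakly_hypercyclic_vector (V := X) T x.
Proof.
move=> whc; have [q0 q1] := andP q01.
have d0 : 0 < delta by rewrite lt_neqAle rnorm_ge0 eq_sym rnorm_eq0 fLx.
pose A := 2 * (F * B * rnorm x).
have A0 : 0 <= A by rewrite !mulr_ge0 ?rnorm_ge0 // ltW.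
have [m m0 qm] : exists2 m, (0 < m)%N & q ^+ m <= 2^-1 /\ A * q ^+ m <= delta / 4.
  (* The + 1 covers A = 0, and taking [N.+1] as exponent keeps m positive. *)
  pose e := Num.min 2^-1 (delta / (4 * (A + 1))).
  have A1 : 0 < A + 1 by rewrite ltr_wpDl.
  have e0 : 0 < e by rewrite lt_min invr_gt0 ltr0n divr_gt0 // mulr_gt0.
  have qlt1 : `|q| < 1 by rewrite gtr0_norm.
  have /cvgrPdist_lt /(_ e e0)[N _ hN] := cvg_expr qlt1.
  exists N.+1 => //; have := hN N.+1 (leqnSn N).
  rewrite /= sub0r normrN ger0_norm ?exprn_ge0 ?(ltW q0) // lt_min => /andP[h1 h2].
  split; first exact: ltW.
  apply: le_trans (_ : (A + 1) * q ^+ N.+1 <= _).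
    by rewrite ler_wpM2r ?exprn_ge0 ?lerDl // ltW.
  rewrite mulrC -ler_pdivlMr //; apply: le_trans (ltW h2) _.
  by rewrite invfM mulrA.
have [G hG] := choice (fun r : 'I_m => escaping_operator r qm.1 qm.2).
pose phi (r : 'I_m) : {linear X -> R[i]^o} := f \o G r.
have [||n hn] := @weakly_hypercyclic_approx R X T x m phi 0 (delta / 4) whc.
- move=> r; have [/bounded_operatorP[K K0 hK] _] := hG r.
  apply/bounded_operatorP; exists (F * K) => [|v]; first exact: mulr_gt0.
  by apply: le_trans (f_bound _) _; rewrite -mulrA ler_pM2l.
- by rewrite divr_gt0.
have := hn (Ordinal (ltn_pmod n m0)); have [_ /(_ (n %/ m)%N)] := hG (Ordinal (ltn_pmod n m0)).
by rewrite /= mulnC addnC -divn_eq linear0 linear0 subr0 leNgt => /negP.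
Qed.

End OrbitEscape.

(** * Weakly dense orbits under Riesz operators *)

Section RieszOrbits.
Variables (R : realType) (X : completeNormedModType R[i]) (T : {linear X -> X}).
Variables (E : seq (R[i] * R[i] * R[i])) (U : set R[i]).
Variables (S : R[i] -> {linear X -> X}) (M D : R).
Hypothesis T_bounded : bounded_operator T.
Hypothesis M0 : 0 < M.
Hypothesis S_resolvent : forall z, contour_support E z -> resolvent T z (S z).
Hypothesis S_bound :
  forall z x, contour_support E z -> rnorm (S z x) <= M * rnorm x.
Hypothesis EU : contour_support E `<=` U.
Hypothesis U_bounded : forall z, U z -> rnorm z <= D.
Hypothesis cauchy : forall h : R[i] -> R[i]^o,
  uniformly_differentiable U h -> contour_integral E h 0.
Variable x : X.
Hypothesis whc : weakly_hypercyclic_vector (V := X) T x.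
Hypothesis riesz1 : exists v, riesz E S (fun=> 1) v != 0.

Let smooth h (hU : uniformly_differentiable U h) :
  uniformly_differentiable (contour_support E) h :=
  uniformly_differentiable_sub EU hU.

Let one_U : uniformly_differentiable U (fun=> 1) :=
  uniformly_differentiable_cst U 1.

Let id_U : uniformly_differentiable U id := uniformly_differentiable_id U_bounded.

Let weight_ge0 : 0 <= contour_weight E.
Proof. by apply: sumr_ge0 => e _; exact: rnorm_ge0. Qed.

Let pack h (hU : uniformly_differentiable U h) : {linear X -> X} :=
  HB.pack (riesz E S h)
    (GRing.isLinear.Build _ _ _ _ _ (riesz_linear M0 S_resolvent S_bound (smooth hU))).

(** Each application of T multiplies h by z: the extra term of [riesz_mul] vanishes by Cauchy's
    theorem. *)
Lemma riesz_iter h n v : uniformly_differentiable U h ->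
  riesz E S h (iter n T v) = riesz E S (fun z => h z * z ^+ n) v.
Proof.
elim: n h => [|n IH] h hU.
  by rewrite (_ : (fun z => h z * z ^+ 0) = h) //; apply: funext => z; rewrite expr0 mulr1.
have hU' := uniformly_differentiableM hU id_U.
rewrite iterS (riesz_mul M0 S_resolvent S_bound _ (smooth hU) (smooth hU') (cauchy hU)).
rewrite scale0r add0r IH // 
  (_ : (fun z => h z * z * z ^+ n) = (fun z => h z * z ^+ n.+1)) //.
by apply: funext => z; rewrite exprS mulrA.
Qed.

Lemma not_weakly_hypercyclic_inside : ~ forall z, U z -> rnorm z <= 1.
Proof.
move=> U1; have [v v0] := riesz1.
have [f bf fv0] := exists_functional v0.
have /bounded_operatorP[F F0 bF] := bf.
have [B B0 hB] := riesz_bounded M0 S_resolvent S_bound (smooth one_U).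
pose phi : {linear X -> R[i]^o} := f \o pack one_U.
pose K := F * (contour_weight E * (1 * (M * rnorm x))).
(* Scaled so that phi (c v) has modulus K + 1, at distance at least 1 from the values on the orbit,
   which are bounded by K. *)
pose c := (K + 1) / rnorm (f (riesz E S (fun=> 1) v)).
have fv_gt0 : 0 < rnorm (f (riesz E S (fun=> 1) v)).
  by rewrite lt_neqAle rnorm_ge0 eq_sym rnorm_eq0 fv0.
have K0 : 0 <= K by rewrite !mulr_ge0 ?rnorm_ge0 // ltW.
have [||n /(_ ord0) hn] := @weakly_hypercyclic_approx R X T x 1 (fun=> phi)
    (c%:C *: v) 1 whc.
- move=> _; apply/bounded_operatorP; exists (F * B) => [|y]; first exact: mulr_gt0.
  by apply: le_trans (bF _) _; rewrite -mulrA ler_pM2l // hB.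
- exact: ltr01.
have h1 : rnorm (phi (iter n T x)) <= K.
  rewrite /phi /=; apply: le_trans (bF _) _; rewrite ler_pM2l //.
  rewrite riesz_iter //; apply: (rnorm_riesz M0 S_resolvent S_bound).
    by apply: smooth; apply: uniformly_differentiableM one_U _;
      exact: uniformly_differentiableX.
  move=> z /EU/U1 z1; rewrite mul1r rnormX; exact: exprn_ile1 (rnorm_ge0 _) z1.
have h2 : rnorm (phi (c%:C *: v)) = K + 1.
  rewrite linearZ /= -[_ *: _]/(_ * _) rnormM rnorm_real ger0_norm.
    by rewrite /c mulfVK // gt_eqF.
  by rewrite divr_ge0 ?addr_ge0 // ltW.
have := ler_rnormB (phi (c%:C *: v)) (phi (iter n T x)).
rewrite (rdistC (phi (c%:C *: v))) h2; lra.
Qed.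

Lemma not_weakly_hypercyclic_outside (rho : R) : 1 < rho ->
  ~ forall z, U z -> rho <= rnorm z.
Proof.
move=> rho1 Urho; have rho0 : 0 < rho by lra.
(* The form z - 0 fits [uniformly_differentiableV] with a = 0. *)
have U0 z : U z -> rho <= rnorm (z - 0) by rewrite subr0; exact: Urho.
have inv_U : uniformly_differentiable U (fun z => (z - 0)^-1).
  exact: uniformly_differentiableV rho0 U0.
have pow_U j := uniformly_differentiableX j inv_U.
(* 1(T) commutes with T, so if it killed x it would kill the whole orbit, and phi could not
   approximate its nonzero value at v. *)
have Px0 : riesz E S (fun=> 1) x != 0.
  apply/eqP => Px0; have [v v0] := riesz1.
  have [f bf fv0] := exists_functional v0.
  have /bounded_operatorP[F F0 bF] := bf.
  have [B B0 hB] := riesz_bounded M0 S_resolvent S_bound (smooth one_U).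
  pose phi : {linear X -> R[i]^o} := f \o pack one_U.
  have [||n /(_ ord0)] := @weakly_hypercyclic_approx R X T x 1 (fun=> phi)
      v (rnorm (phi v)) whc.
  - move=> _; apply/bounded_operatorP; exists (F * B) => [|y]; first exact: mulr_gt0.
    by apply: le_trans (bF _) _; rewrite -mulrA ler_pM2l // hB.
  - by rewrite lt_neqAle rnorm_ge0 eq_sym rnorm_eq0 /phi /= fv0.
  have -> : phi (iter n T x) = 0.
    rewrite /phi /=; have -> : riesz E S (fun=> 1) (iter n T x) = 0.
      elim: n => [|n IH] //=.
      by rewrite (riesz_commutes T_bounded M0 S_resolvent S_bound _ (smooth one_U)) IH linear0.
    exact: linear0.
  by rewrite sub0r rnormN ltxx.
have [f bf fx0] := exists_functional Px0.
have /bounded_operatorP[F F0 bF] := bf.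
apply: (@escaping_orbit_not_weakly_dense R X T x (fun j => pack (pow_U j)) f
  F (contour_weight E * M) rho^-1) => //.
- by rewrite mulr_ge0 // ltW.
- by rewrite invr_gt0 rho0 invf_lt1.
- move=> j y /=; rewrite -!mulrA [M * _]mulrCA.
  apply: (rnorm_riesz M0 S_resolvent S_bound) (smooth (pow_U j)) _ => z /EU Uz.
  rewrite rnormX rnormV; apply: lerXn2r.
  + by rewrite nnegrE invr_ge0 rnorm_ge0.
  + by rewrite nnegrE invr_ge0 ltW.
  by rewrite lef_pV2 ?posrE ?U0 // (lt_le_trans rho0) // U0.
- move=> k j /=; rewrite riesz_iter //.
  apply: (eq_riesz M0 S_resolvent S_bound).
  + by apply: smooth; apply: uniformly_differentiableM (pow_U _) _;
      exact: uniformly_differentiableX.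
  + exact/smooth/pow_U.
  move=> z /EU/U0 zrho; rewrite exprD mulrAC -exprMn subr0 mulVf ?expr1n ?mul1r //.
  by rewrite -rnorm_eq0 gt_eqF // (lt_le_trans rho0) // -[z]subr0.
Qed.

End RieszOrbits.

Theorem theorem3 (R : realType) (X : completeNormedModType R[i])
    (T : {linear X -> X})
    (X_neq0 : exists x : X, x != 0)
    (T_bounded : bounded_operator T)
    (T_whc : weakly_hypercyclic T) :
  forall C : set R[i]^o, is_component (spectrum T) C ->
    C `&` [set z : R[i]^o | `|z| = 1] !=set0.
Proof.
move=> C [l Tl ->]; apply: contrapT => hC.
have [x whc] := T_whc.
have [|e e0 [S1 [S1T S1l S1sep side]]] :=
  @component_avoiding_circle R (spectrum T) l Tl (compact_spectrum T_bounded).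
  move=> z Cz; apply/eqP => z1; apply: hC; exists z; split=> //=.
  by rewrite norm_rnorm z1.
(* With half of e the contour and its neighbourhood U of S1 remain at distance e / 2 from the
   circle. *)
have e20 : 0 < e / 2 by rewrite divr_gt0.
have /bounded_operatorP[N N0 hN] := T_bounded.
have e2 : e / 2 < e by lra.
have [E [Eout Ecauchy Ewind]] := separating_contour S1T S1l
  (spectrum_bounded hN) e20 (fun z w S1z Tw zw => S1sep z w S1z Tw (lt_trans zw e2)).
set U := [set z | _] in Eout Ecauchy.
have [S [M [M0 hS]]] : exists (S : R[i] -> {linear X -> X}) (M : R), 0 < M /\
    forall z, contour_support E z -> resolvent T z (S z) /\
      forall x, rnorm (S z x) <= M * rnorm x.
  by apply: resolvent_bound_contour => z /Eout[].
have S_resolvent z : contour_support E z -> resolvent T z (S z) by move=> /hS[].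
have S_bound z v : contour_support E z -> rnorm (S z v) <= M * rnorm v.
  by move=> /hS[].
have EU : contour_support E `<=` U by move=> z /Eout[].
have U_bounded z : U z -> rnorm z <= 2 * `|N| + 1 + e / 2.
  move=> [u S1u uz]; have := spectrum_bounded hN (S1T _ S1u).
  have := ler_rnormB z u; lra.
have riesz1 : exists v, riesz E S (fun=> 1) v != 0.
  apply: (riesz1_neq0 T_bounded M0 S_resolvent S_bound X_neq0 Tl _ Ewind).
  by move=> z /EU; exact: U_bounded.
case: side => side.
  apply: (not_weakly_hypercyclic_inside M0 S_resolvent S_bound EU
    U_bounded Ecauchy whc riesz1) => z [u S1u uz].
  by have := side u S1u; have := ler_rnormB z u; lra.
have rho1 : 1 < 1 + e / 2 by lra.
apply: (not_weakly_hypercyclic_outside T_bounded M0 S_resolvent S_bound EU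
  U_bounded Ecauchy whc riesz1 rho1) => z [u S1u uz].
by have := side u S1u; have := ler_rnormB u z; rewrite (rdistC u); lra.
Qed.
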